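(* Let $p\ge1$, $\nu,\mu,\gamma>0$, $L>0$, $I=(-L,L)$, and let $F:\mathbb R\to\mathbb R$ satisfy, for some constant $K>0$ and all $x,y\ge0$, $$|F(x)-F(y)|\le K(|x|^{p-1}+|y|^{p-1})|x-y|,\qquad F(0)=0,\qquad|F'(x)|\le K|x|^{p-1}.$$ Consider the integrable and non-integrable focusing NLS equations $$iu_t+\nu u_{xx}+\mu|u|^2u=0,\qquad iU_t+\nu U_{xx}+\gamma F(|U|^2)U=0,\qquad x\in I,$$ with initial conditions $u(x,0)=u_0(x)$, $U(x,0)=U_0(x)$ and the periodic boundary conditions $u(-L,t)=u(L,t)$, $U(-L,t)=U(L,t)$, $t\ge0$. (i) ($L^2$ closeness) Let $0<\varepsilon<1$ and suppose that $$\|u_0-U_0\|_{L^2(I)}\le C\varepsilon^3,\qquad\|u_0\|_{H^1(I)}\le c_0\varepsilon,\qquad\|U_0\|_{H^1(I)}\le C_0\varepsilon$$ for some constants $c_0,C_0,C>0$. Then, for arbitrary finite $0<T_f<\infty$, there exists a constant $\widetilde C=\widetilde C(\mu,\gamma,c_0,C_0,C,T_f)$ such that $$\sup_{t\in[0,T_f]}\|u(t)-U(t)\|_{L^2(I)}\le\widetilde C\varepsilon^3.$$ (ii) ($H^1$ and $L^\infty$ closeness) Suppose that $\|u_0\|_{H^1(I)}\le c_0\varepsilon$, $\|U_0\|_{H^1(I)}\le C_0\varepsilon$ and, instead of the $L^2$ condition on the difference, the stronger condition $$\|u_0-U_0\|_{H^1(I)}\le C_1\varepsilon^3$$ holds for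 some constant $C_1$. Then there exists a constant $\widetilde C_1$ with similar dependencies as $\widetilde C$ such that $$\sup_{t\in[0,T_f]}\|u(t)-U(t)\|_{H^1(I)}\le\widetilde C_1\varepsilon^3$$ and, in turn, for a constant $\widetilde C_2$, $$\sup_{t\in[0,T_f]}\|u(t)-U(t)\|_{L^\infty(I)}\le\widetilde C_2\varepsilon^3.$$
   Context: $F$ (with $p,K$), $\nu$ and $L$ are regarded as fixed; the constants $\widetilde C,\widetilde C_1,\widetilde C_2$ do not depend on $\varepsilon$. $H^1(I)$ here refers to $2L$-periodic functions. The solutions $u,U$ are the global-in-time periodic $H^1$ solutions provided by the known well-posedness theory, which the paper uses: (for $1\le p<2$ for all $H^1$ data; for $p\ge2$ for data with sufficiently small $H^1$ norm) the solution exists globally and satisfies $\sup_{t\ge0}\|U(t)\|_{H^1(I)}\le M\|U_0\|_{H^1(I)}$ for a constant $M>0$ independent of $t$, and similarly for $u$ (the case $p=1$). *)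

(* Defs.v *)
From HB Require Import structures.
From mathcomp Require Import all_boot all_order all_algebra complex.
From mathcomp Require Import all_classical all_reals all_analysis.

Set Implicit Arguments.
Unset Strict Implicit.
Unset Printing Implicit Defensive.

Import Order.TTheory GRing.Theory Num.Theory.
Import numFieldNormedType.Exports.
Import ComplexField.Normc.

Local Open Scope classical_set_scope.
Local Open Scope complex_scope.
Local Open Scope ring_scope.

Section PeriodicH1.
Context {R : realType}.
Implicit Types (L nu t : R) (f g : R -> R[i]).

Local Notation mu := (@lebesgue_measure R).

Definition Itv L : set R := `]- L, L[.

Definition cintegral (D : set R) f : R[i] :=
  (\int[mu]_(x in D) complex.Re (f x)) +i* (\int[mu]_(x in D) complex.Im (f x)).

(* Hermitian L^2 product on (-L, L), antilinear in the second argument. *)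
Definition dotI L f g : R[i] := cintegral (Itv L) (fun x => f x * (g x)^*).

Definition sqnormI L f : \bar R := (\int[mu]_(x in Itv L) (normc (f x) ^+ 2)%:E)%E.

Definition L2norm L f : \bar R := (sqnormI L f `^ 2^-1)%E.

Definition Linfnorm L f : \bar R :=
  ('N[mrestr mu (measurable_itv `]- L, L[%R)]_+oo [(fun x => (normc (f x))%:E)])%E.

(* f is locally absolutely continuous with 2L-periodic weak derivative g in
   L^2(-L, L).  Functions on the circle R / 2LZ are represented by 2L-periodic
   functions on R, and an H^1 class by its continuous representative, so that
   pointwise boundary and initial values make sense; in particular
   f (- L) = f L. *)
Definition weak_derivative L f g : Prop :=
  [/\ periodic g (L *+ 2),
      measurable_fun setT (fun x => complex.Re (g x)),
      measurable_fun setT (fun x => complex.Im (g x)),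
      (sqnormI L g < +oo)%E &
      forall a b : R, a <= b -> f b - f a = cintegral `[a, b] g].

Definition H1per L f : Prop :=
  periodic f (L *+ 2) /\ exists g, weak_derivative L f g.

(* g above is unique up to a null set, so the choice is immaterial inside
   integrals; the value is junk when f is not in H^1. *)
Definition wderiv L f : R -> R[i] :=
  xget (fun=> 0) [set g | weak_derivative L f g].

Definition H1norm L f : \bar R :=
  ((sqnormI L f + sqnormI L (wderiv L f)) `^ 2^-1)%E.

Definition is_cderive (h : R -> R[i]) t (l : R[i]) : Prop :=
  is_derive t 1 (fun s => complex.Re (h s)) (complex.Re l) /\
  is_derive t 1 (fun s => complex.Im (h s)) (complex.Im l).

(* v in C([0, +oo[; H^1_per) solves i v_t + nu v_xx + G(|v|^2) v = 0, v(0) = v0,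
   the equation being read in the dual of H^1_per: pairing with phi and
   integrating nu v_xx by parts over a period gives
     i <v_t, phi> = nu <v_x, phi_x> - <G(|v|^2) v, phi>.
   Only the values v t with t >= 0 matter. *)
Definition NLS_solution nu L (G : R -> R) (v0 : R -> R[i])
    (v : R -> R -> R[i]) : Prop :=
  [/\ forall t, 0 <= t -> H1per L (v t),
      v 0 = v0,
      forall t, 0 <= t ->
        H1norm L (v s \- v t) @[s --> within `[0, +oo[ (nbhs t)] --> 0%E &
      forall phi, H1per L phi -> forall t, 0 < t ->
        is_cderive (fun s => 'i * dotI L (v s) phi) t
          (nu%:C * dotI L (wderiv L (v t)) (wderiv L phi)
           - dotI L (fun x => (G (normc (v t x) ^+ 2))%:C * v t x) phi)].

End PeriodicH1.

(* Main.v *)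
(* Set w = u - U, so that i w_t + nu w_xx + N = 0 with N the difference of the
   two cubic-type terms.  The H^1 bounds and the Sobolev embedding give
   |u|, |U| <= r = O(eps); on |z| <= r each nonlinearity z |-> G(|z|^2) z is
   Lipschitz with constant O(r^2), because G is Lipschitz near 0 and G 0 = 0.
   Hence ||N|| = O(eps^3) in L^2, and ||w(t)|| <= ||w(0)|| + O(t eps^3) by the
   energy method.  In the weak formulation the energy identity comes from
   testing with the time-independent function w(s) + w(r), since
   ||w(s)||^2 - ||w(r)||^2 = Re <w(s) - w(r), w(s) + w(r)>.
   For the H^1 estimate the same argument is applied to w(. + h) - w, whose
   forcing term is O(h eps^3) by the Lipschitz bound, so the nonlinearity never
   has to be differentiated; dividing by h and letting h tend to 0 (Lebesgue
   differentiation and Fatou) bounds w_x. *)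
Require Import Defs.
From HB Require Import structures.
From mathcomp Require Import all_boot all_order all_algebra complex.
From mathcomp Require Import all_classical all_reals all_analysis.
From mathcomp Require Import measurable_realfun ess_sup_inf.
From mathcomp Require Import ring lra.

Set Implicit Arguments.
Unset Strict Implicit.
Unset Printing Implicit Defensive.

Import Order.TTheory GRing.Theory Num.Theory.
Import numFieldNormedType.Exports.

Local Open Scope classical_set_scope.
Local Open Scope ring_scope.

(** * Translation of integrals and periodic functions *)

Section PeriodicIntegral.
Context {R : realType}.
Local Notation mu := (@lebesgue_measure R).
Implicit Types (k : R -> \bar R) (a b h T L : R).

(** No Gronwall argument occurs. The H^1 bounds hold at all times, so each nonlinear term is small
    by itself and acts as a given forcing of a linear equation. The two nonlinearities are never
    compared with each other, so [mu * r] and [gamma * F r] may be unrelated.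

    The obstacle is weak regularity in time: the equation differentiates [rdot (w s) phi] for a
    fixed [phi] only, so the squared norm of [w] is not known to be differentiable. Slope bounds on
    short time intervals take the place of its derivative and are patched together by a supremum
    argument.

    For w_x the energy method cannot be applied directly, since w_x is merely L^2 and is no
    admissible test function. The increments w(. + h) - w stay in H^1.

    The derivative [wderiv] is a choice among functions equal almost everywhere, hence not literally
    additive. Estimates are therefore stated for explicit pairs of a function and one of its weak
    derivatives, and uniqueness almost everywhere returns to the norms of the statement. *)

Lemma measurable_shift h : measurable_fun [set: R] (fun x : R => x + h).
Proof. by apply: measurable_funD => //; exact: measurable_id. Qed.

Lemma lebesgue_measure_shift h (A : set R) : measurable A ->
  pushforward mu (fun x : R => (x + h)%R : measurableTypeR R) A = mu A.
Proof.
move=> mA; apply/esym/lebesgue_measure_unique => //=; first exact: measurable_shift.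
move=> mf _ [[a b]] _ <-.
rewrite /pushforward (_ : _ @^-1` _ = `]a - h, b - h]%classic); last first.
  by apply/seteqP; split => x /=; rewrite !in_itv/= ltrBlDr lerBrDr.
rewrite !lebesgue_measure_itv/= !lte_fin ltrD2r -!EFinB.
by rewrite opprB addrA addrNK.
Qed.

Local Open Scope ereal_scope.

Lemma ge0_integral_shift k h (D : set R) :
  measurable D -> measurable_fun [set: R] k -> (forall x, 0 <= k x) ->
  \int[mu]_(x in (fun x => x + h)%R @^-1` D) k (x + h)%R = \int[mu]_(x in D) k x.
Proof.
move=> mD mk k0.
pose phi : measurableTypeR R -> measurableTypeR R := fun x : R => (x + h)%R.
have mphi : measurable_fun setT phi by exact: measurable_shift.
transitivity (\int[pushforward mu phi]_(x in D) k x).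
  by rewrite (ge0_integral_pushforward mphi)//; exact: measurable_funTS.
by apply: eq_measure_integral => //= A mA _; exact: lebesgue_measure_shift.
Qed.

Lemma ge0_integral_shift_itv k h a b :
  measurable_fun [set: R] k -> (forall x, 0 <= k x) ->
  \int[mu]_(x in `]a, b]) k (x + h)%R = \int[mu]_(x in `](a + h)%R, (b + h)%R]) k x.
Proof.
move=> mk k0; rewrite -(@ge0_integral_shift k h)//.
congr (integral _ _ _).
by apply/seteqP; split => x /=; rewrite !in_itv/= ltrD2r lerD2r.
Qed.

Lemma integral_shift k h (D : set R) : measurable D -> measurable_fun [set: R] k ->
  \int[mu]_(x in (fun x => x + h)%R @^-1` D) k (x + h)%R = \int[mu]_(x in D) k x.
Proof.
move=> mD mk; rewrite integralE [RHS]integralE; congr (_ - _).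
- rewrite -(ge0_integral_shift h mD (measurable_funepos mk)); last by move=> x; exact: funepos_ge0.
  by apply: eq_integral => x _; rewrite /= !funeposE.
- rewrite -(ge0_integral_shift h mD (measurable_funeneg mk)); last by move=> x; exact: funeneg_ge0.
  by apply: eq_integral => x _; rewrite /= !funenegE.
Qed.

Lemma ge0_integral_itv_split k a b c : (a <= b)%R -> (b <= c)%R ->
  measurable_fun [set: R] k -> (forall x, 0 <= k x) ->
  \int[mu]_(x in `]a, c]) k x = \int[mu]_(x in `]a, b]) k x + \int[mu]_(x in `]b, c]) k x.
Proof.
move=> ab bc mk k0.
rewrite -ge0_integral_setU//=.
- congr (integral _ _ _); rewrite -itv_bndbnd_setU//.
- exact: measurable_funS mk.
- apply/disj_setPS => x [/=]; rewrite !in_itv/= => /andP[_ xb] /andP[bx _].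
  by rewrite ltNge xb in bx.
Qed.

Lemma ge0_integral_period k T a b : (0 < T)%R -> (forall x, k (x + T)%R = k x) ->
  measurable_fun [set: R] k -> (forall x, 0 <= k x) ->
  \int[mu]_(x in `]a, (a + T)%R]) k x = \int[mu]_(x in `]b, (b + T)%R]) k x.
Proof.
move=> T0 kT mk k0.
have shT x y : \int[mu]_(z in `](x + T)%R, (y + T)%R]) k z = \int[mu]_(z in `]x, y]) k z.
  by rewrite -ge0_integral_shift_itv//; apply: eq_integral => z _; rewrite kT.
(* Induction on the number of periods between [a] and [b]. If [b] lies within one period of [a], the
   windows overlap in []b, a + T]] and the two remaining pieces are translates of each other by
   [T]. *)
have aux n : forall a b, (a <= b)%R -> (b <= a + T *+ n)%R ->
    \int[mu]_(x in `]a, (a + T)%R]) k x = \int[mu]_(x in `]b, (b + T)%R]) k x.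
  elim: n => [|n IH] {}a {}b ab.
    rewrite mulr0n addr0 => ba; have -> // : a = b by apply/eqP; rewrite eq_le ab.
  have [baT _|baT bn] := leP b (a + T)%R; last first.
    by rewrite -shT; apply: IH; [exact: ltW|rewrite -addrA -mulrS].
  rewrite (@ge0_integral_itv_split k a b (a + T)%R)//.
  by rewrite (@ge0_integral_itv_split k b (a + T)%R (b + T)%R) ?lerD2r// shT addeC.
wlog ab : a b / (a <= b)%R.
  by move=> H; have [/H//|/ltW/H] := leP a b; exact: esym.
have := archi_boundP (divr_ge0 _ (ltW T0)); move=> /(_ (b - a)%R).
rewrite subr_ge0 => /(_ ab); set n := Num.bound _ => Hn.
apply: (aux n) => //; rewrite -lerBlDl -[(T *+ n)%R]mulr_natr -ler_pdivrMl// mulrC.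
exact/ltW.
Qed.

Lemma ge0_integral_itv_lty k T a b : (0 < T)%R -> (forall x, k (x + T)%R = k x) ->
  measurable_fun [set: R] k -> (forall x, 0 <= k x) ->
  \int[mu]_(x in `]0%R, T]) k x < +oo -> \int[mu]_(x in `]a, b]) k x < +oo.
Proof.
move=> T0 kT mk k0 kfin.
have aux n : \int[mu]_(x in `]a, (a + T *+ n)%R]) k x < +oo.
  elim: n => [|n IH]; first by rewrite mulr0n addr0 set_itvoc0 integral_set0.
  rewrite (@ge0_integral_itv_split k a (a + T *+ n)%R)//.
  - apply: lte_add_pinfty => //.
    by rewrite mulrSr addrA (@ge0_integral_period k T _ 0%R)// add0r.
  - by rewrite lerDl mulrn_wge0// ltW.
  - by rewrite lerD2l mulrSr lerDl ltW.
have [ab|ba] := leP a b; last by rewrite set_itv_ge ?integral_set0// bnd_simp -leNgt ltW.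
have := archi_boundP (divr_ge0 _ (ltW T0)); move=> /(_ (b - a)%R).
rewrite subr_ge0 => /(_ ab); set n := Num.bound _ => Hn.
apply: le_lt_trans (aux n); apply: ge0_subset_integral => //.
  exact: measurable_funTS.
apply: subset_itvl; rewrite bnd_simp -lerBlDl -[(T *+ n)%R]mulr_natr -ler_pdivrMl// mulrC.
exact/ltW.
Qed.

Lemma ge0_integral_itv_oo_shift k L h : (0 < L)%R -> (forall x, k (x + L *+ 2)%R = k x) ->
  measurable_fun [set: R] k -> (forall x, 0 <= k x) ->
  \int[mu]_(x in `](- L)%R, L[) k (x + h)%R = \int[mu]_(x in `](- L)%R, L[) k x.
Proof.
move=> L0 kL mk k0.
have mkh : measurable_fun [set: R] (fun x => k (x + h)%R).
  by apply: measurableT_comp => //; exact: measurable_shift.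
rewrite !integral_itv_bndo_bndc; [|exact: measurable_funTS..].
rewrite ge0_integral_shift_itv//.
have L2 : (0 < L *+ 2)%R by rewrite pmulrn_lgt0.
have /(_ (- L + h)%R (- L)%R) := ge0_integral_period _ _ L2 kL mk k0.
have -> : (- L + h + L *+ 2 = L + h)%R by ring.
by have -> : (- L + L *+ 2 = L)%R by ring.
Qed.

End PeriodicIntegral.

(** * Square-integrable functions *)

(** Evaluate at the minimiser [- B / C]. For [C = 0] the polynomial is affine, and a nonzero [B]
    would let it reach -1. *)
Lemma discriminant_le (R : realFieldType) (A B C : R) : 0 <= C ->
  (forall t, 0 <= A + 2 * t * B + t ^+ 2 * C) -> B ^+ 2 <= A * C.
Proof.
move=> C0 H; have [C1|C1] := eqVneq C 0.
  have [->|B0] := eqVneq B 0; first by rewrite C1 mulr0 expr0n.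
  have := H (- (A + 1) / (2 * B)).
  rewrite C1 mulr0 addr0 (_ : 2 * _ * _ = - (A + 1)); last by field; rewrite B0.
  by rewrite opprD addrA subrr add0r ler0N1.
have := H (- B / C).
rewrite (_ : _ + _ = (A * C - B ^+ 2) / C); last by field; rewrite C1.
by rewrite pmulr_lge0 ?subr_ge0// invr_gt0 lt_neqAle eq_sym C1.
Qed.

Section CauchySchwarz.
Context d (T : measurableType d) (R : realType) (mu : {measure set T -> \bar R}).
Implicit Types (D : set T) (u v : T -> R).

(** Three densities replace a product of two functions so that the inequality also covers [rdot],
    whose density is a sum of two products. The pointwise quadratic in [t] is integrated and its
    discriminant taken. *)
Lemma cauchy_schwarz_Rintegral D (a b c : T -> R) : measurable D ->
  mu.-integrable D (EFin \o a) -> mu.-integrable D (EFin \o b) ->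
  mu.-integrable D (EFin \o c) -> (forall x, 0 <= c x) ->
  (forall x t, 0 <= a x + 2 * t * b x + t ^+ 2 * c x) ->
  (\int[mu]_(x in D) b x) ^+ 2 <= \int[mu]_(x in D) a x * \int[mu]_(x in D) c x.
Proof.
move=> mD ia ib ic c0 H; apply: discriminant_le => [|t]; first exact: Rintegral_ge0.
have ib' : mu.-integrable D (EFin \o (fun x => 2 * t * b x)).
  exact: (integrableZl mD (2 * t) ib).
have ic' : mu.-integrable D (EFin \o (fun x => t ^+ 2 * c x)).
  exact: (integrableZl mD (t ^+ 2) ic).
rewrite -!RintegralZl// -RintegralD// -RintegralD//.
  by apply: Rintegral_ge0 => x _; exact: H.
exact: (integrableD mD ia ib').
Qed.

Definition sq_integrable D u :=
  measurable_fun [set: T] u /\ (\int[mu]_(x in D) (u x ^+ 2)%:E < +oo)%E.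

Lemma sq_integrable_integrable D u : measurable D -> sq_integrable D u ->
  mu.-integrable D (EFin \o (fun x => u x ^+ 2)).
Proof.
move=> mD [mu_ iu]; apply/integrableP; split.
  by apply/measurable_EFinP; apply: measurable_funTS; exact: measurable_funX.
under eq_integral do rewrite /= ger0_norm ?sqr_ge0//.
exact: iu.
Qed.

Lemma integrable_sq_integrable D u : measurable_fun [set: T] u ->
  mu.-integrable D (EFin \o (fun x => u x ^+ 2)) -> sq_integrable D u.
Proof.
move=> mu_ /integrableP[_ iu]; split => //; move: iu.
by under eq_integral do rewrite /= ger0_norm ?sqr_ge0//.
Qed.

Lemma sq_integrableM D u v : measurable D -> sq_integrable D u -> sq_integrable D v ->
  mu.-integrable D (EFin \o (fun x => u x * v x)).
Proof.
move=> mD iu iv.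
have := integrableD mD (sq_integrable_integrable mD iu) (sq_integrable_integrable mD iv).
apply: le_integrable => //.
  apply/measurable_EFinP; apply: measurable_funTS.
  by apply: measurable_funM; [case: iu|case: iv].
move=> x _ /=; rewrite lee_fin [leRHS]ger0_norm ?addr_ge0 ?sqr_ge0// normrM.
rewrite -(real_normK (num_real (u x))) -(real_normK (num_real (v x))).
by have := sqr_ge0 (`|u x| - `|v x|); nra.
Qed.

Lemma integrable_cst_lty D (c : R) : measurable D -> (mu D < +oo)%E ->
  mu.-integrable D (EFin \o cst c).
Proof.
move=> mD Dfin; apply/integrableP; split; first by apply/measurable_EFinP.
rewrite (_ : (fun _ => _) = cst `|c|%:E)//= integral_cst//.
by rewrite lte_mul_pinfty// lee_fin.
Qed.

Lemma sq_integrable_cst D (c : R) : measurable D -> (mu D < +oo)%E ->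
  sq_integrable D (cst c).
Proof.
move=> mD Dfin; apply: integrable_sq_integrable => //=.
exact: integrable_cst_lty.
Qed.

Lemma sq_integrable_integrable1 D u : measurable D -> (mu D < +oo)%E ->
  sq_integrable D u -> mu.-integrable D (EFin \o u).
Proof.
move=> mD Dfin iu.
have := sq_integrableM mD iu (sq_integrable_cst 1 mD Dfin).
by under [fun x => u x * _]eq_fun do rewrite mulr1.
Qed.

Lemma sq_integrableD D u v : measurable D -> sq_integrable D u -> sq_integrable D v ->
  sq_integrable D (fun x => u x + v x).
Proof.
move=> mD iu iv; apply: integrable_sq_integrable.
  by apply: measurable_funD; [case: iu|case: iv].
have iuv := sq_integrableM mD iu iv.
rewrite (_ : _ \o _ = ((EFin \o (fun x => u x ^+ 2)%R) \+ (EFin \o (fun x => v x ^+ 2)%R)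
   \+ ((EFin \o (fun x => u x * v x)%R) \+ (EFin \o (fun x => u x * v x)%R)))%E); last first.
  by apply/funext => x /=; rewrite -!EFinD; congr EFin; ring.
by apply: integrableD => //; apply: integrableD => //; exact: sq_integrable_integrable.
Qed.

Lemma sq_integrableZ D (c : R) u : measurable D -> sq_integrable D u ->
  sq_integrable D (fun x => c * u x).
Proof.
move=> mD iu; apply: integrable_sq_integrable.
  by apply: measurable_funM => //; case: iu.
have := integrableZl mD (c ^+ 2) (sq_integrable_integrable mD iu).
rewrite [X in _ -> mu.-integrable _ X](_ : _ = (fun x => (c ^+ 2)%:E * (u x ^+ 2)%:E)%E)//.
by apply/funext => x /=; rewrite -!EFinM; congr EFin; ring.
Qed.

End CauchySchwarz.

Section IntervalCauchySchwarz.
Context {R : realType}.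
Local Notation mu := (@lebesgue_measure R).

Lemma lebesgue_measure_itv_lty (a b : R) : (mu `[a, b] < +oo)%E.
Proof. by rewrite lebesgue_measure_itv/=; case: ifP => // _; rewrite -EFinB ltry. Qed.

Lemma sqr_Rintegral_le (a b : R) (u : R -> R) : a <= b -> sq_integrable mu `[a, b] u ->
  (\int[mu]_(x in `[a, b]) u x) ^+ 2 <= (b - a) * \int[mu]_(x in `[a, b]) (u x ^+ 2).
Proof.
move=> ab iu.
have mab : mu `[a, b] = (b - a)%:E.
  by rewrite lebesgue_measure_itv/= lte_fin; case: ltgtP ab => // -> _; rewrite subrr.
have mfin := lebesgue_measure_itv_lty a b.
have i1 : mu.-integrable `[a, b] (EFin \o cst (1 : R)).
  exact: integrable_cst_lty.
have H x t : 0 <= u x ^+ 2 + 2 * t * u x + t ^+ 2 * cst 1 x.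
  by rewrite /=; have := sqr_ge0 (u x + t); nra.
have := cauchy_schwarz_Rintegral _ _ _ i1 (fun _ => ler01) H.
rewrite Rintegral_cst//= mab /= mul1r mulrC; apply => //.
  exact: sq_integrable_integrable.
exact: sq_integrable_integrable1.
Qed.

End IntervalCauchySchwarz.

(** * Periodic L^2 functions *)

Section L2per.
Context {R : realType}.
Local Notation mu := (@lebesgue_measure R).
Local Notation Re := complex.Re.
Local Notation Im := complex.Im.
Local Notation normc := ComplexField.Normc.normc.
Implicit Types (f g e : R -> R[i]) (z : R[i]).

Lemma normc_sqr z : normc z ^+ 2 = Re z ^+ 2 + Im z ^+ 2.
Proof. by case: z => a b; rewrite /= sqr_sqrtr// addr_ge0// sqr_ge0. Qed.

Lemma normc_eqE z : normc z = Num.sqrt (Re z ^+ 2 + Im z ^+ 2).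
Proof. by case: z. Qed.

Lemma ReD (z w : R[i]) : Re (z + w) = Re z + Re w. Proof. by case: z; case: w. Qed.
Lemma ImD (z w : R[i]) : Im (z + w) = Im z + Im w. Proof. by case: z; case: w. Qed.
Lemma ReN z : Re (- z) = - Re z. Proof. by case: z. Qed.
Lemma ImN z : Im (- z) = - Im z. Proof. by case: z. Qed.
Lemma Re_mul_i z : Re ('i%C * z) = - Im z.
Proof. by case: z => a b /=; rewrite mul0r mul1r add0r. Qed.
Lemma Im_mul_i z : Im ('i%C * z) = Re z.
Proof. by case: z => a b /=; rewrite mul0r mul1r add0r. Qed.
Definition cE := (ReD, ImD, ReN, ImN, Re_mul_i, Im_mul_i).

Context (L : R) (L_gt0 : 0 < L).

Definition L2per f := [/\ periodic f (L *+ 2),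
  measurable_fun [set: R] (fun x => Re (f x)),
  measurable_fun [set: R] (fun x => Im (f x)) & (sqnormI L f < +oo)%E].

(** The real part of [dotI]. It is a real inner product up to null sets; multiplying one argument by
    the imaginary unit gives access to the imaginary part. *)
Definition rdot f g : R :=
  \int[mu]_(x in `]- L, L[) (Re (f x) * Re (g x) + Im (f x) * Im (g x)).

Definition l2norm f : R := Num.sqrt (rdot f f).

Lemma measurable_normc_sqr f : measurable_fun [set: R] (fun x => Re (f x)) ->
  measurable_fun [set: R] (fun x => Im (f x)) ->
  measurable_fun [set: R] (fun x => (normc (f x) ^+ 2)%:E).
Proof.
move=> mr mi; apply/measurable_EFinP; under eq_fun do rewrite normc_sqr.
by apply: measurable_funD; exact: measurable_funX.
Qed.

Lemma L2per_itv_lty f a b : L2per f ->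
  (\int[mu]_(x in `[a, b]) (normc (f x) ^+ 2)%:E < +oo)%E.
Proof.
move=> [pf mr mi fin].
have mk := measurable_normc_sqr mr mi.
have k0 x : (0 <= (normc (f x) ^+ 2)%:E)%E by rewrite lee_fin sqr_ge0.
have L2 : 0 < L *+ 2 by rewrite pmulrn_lgt0.
have kp x : ((normc (f (x + L *+ 2)) ^+ 2)%:E = (normc (f x) ^+ 2)%:E)%E by rewrite pf.
rewrite -integral_itv_obnd_cbnd; last exact: measurable_funTS.
apply: (ge0_integral_itv_lty _ _ L2 kp mk k0).
have := ge0_integral_period 0 (- L) L2 kp mk k0; rewrite add0r => ->.
have -> : - L + L *+ 2 = L by ring.
by rewrite -integral_itv_bndo_bndc//; exact: measurable_funTS.
Qed.

Lemma L2per_sq_integrable_Re f a b : L2per f -> sq_integrable mu `[a, b] (fun x => Re (f x)).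
Proof.
move=> f2; have [pf mr mi fin] := f2; split => //.
apply: le_lt_trans (L2per_itv_lty a b f2); apply: ge0_le_integral => //.
- by move=> x _; rewrite lee_fin sqr_ge0.
- by apply/measurable_EFinP/measurable_funTS; exact: measurable_funX.
- by apply: measurable_funTS; exact: measurable_normc_sqr.
- by move=> x _; rewrite lee_fin normc_sqr lerDl sqr_ge0.
Qed.

Lemma L2per_mul_i f : L2per f -> L2per (fun x => 'i%C * f x).
Proof.
move=> [pf mr mi fin]; split => //.
- by move=> x; rewrite pf.
- by under eq_fun do rewrite Re_mul_i; exact: measurableT_comp.
- by under eq_fun do rewrite Im_mul_i.
- apply: le_lt_trans fin; rewrite /sqnormI le_eqVlt; apply/orP; left; apply/eqP.
  by apply: eq_integral => x _; rewrite !normc_sqr !cE sqrrN addrC.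
Qed.

Lemma L2per_sq_integrable_Im f a b : L2per f -> sq_integrable mu `[a, b] (fun x => Im (f x)).
Proof.
move=> /L2per_mul_i/(L2per_sq_integrable_Re a b) fi.
have mI : measurable (`[a, b] : set (measurableTypeR R)) by [].
have := sq_integrableZ (-1) mI fi.
by congr (sq_integrable _ _ _); apply/funext => x; rewrite Re_mul_i mulN1r opprK.
Qed.

Lemma sq_integrable_subset (D E : set R) (u : R -> R) :
  measurable D -> measurable E -> D `<=` E ->
  sq_integrable mu E u -> sq_integrable mu D u.
Proof.
move=> mD mE DE [mu_ ui]; split => //; apply: le_lt_trans ui.
apply: ge0_subset_integral => //.
  by apply/measurable_EFinP/measurable_funTS; exact: measurable_funX.
by move=> x _; rewrite lee_fin sqr_ge0.
Qed.

Lemma L2per_sq_integrable f : L2per f ->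
  sq_integrable mu `]- L, L[ (fun x => Re (f x)) /\
  sq_integrable mu `]- L, L[ (fun x => Im (f x)).
Proof.
move=> f2; split; apply: (@sq_integrable_subset _ `[- L, L]) => //.
- by move=> x /=; exact: subset_itv_oo_cc.
- exact: L2per_sq_integrable_Re.
- by move=> x /=; exact: subset_itv_oo_cc.
- exact: L2per_sq_integrable_Im.
Qed.

Lemma integrable_rdot f g : L2per f -> L2per g ->
  mu.-integrable `]- L, L[ (EFin \o (fun x => Re (f x) * Re (g x) + Im (f x) * Im (g x))).
Proof.
move=> /L2per_sq_integrable[fr fi] /L2per_sq_integrable[gr gi].
have mI : measurable (`]- L, L[ : set (measurableTypeR R)) by [].
exact: (integrableD mI (sq_integrableM mI fr gr) (sq_integrableM mI fi gi)).
Qed.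

Lemma sqnormIE f : L2per f -> sqnormI L f = (rdot f f)%:E.
Proof.
move=> f2; rewrite /rdot /Rintegral fineK.
  by apply: eq_integral => x _; rewrite normc_sqr !expr2.
by apply: integrable_fin_num => //; exact: integrable_rdot.
Qed.

Lemma rdotC f g : rdot f g = rdot g f.
Proof. by apply: eq_Rintegral => x _; ring. Qed.

Lemma rdotDl f g e : L2per f -> L2per g -> L2per e -> rdot (f \+ g) e = rdot f e + rdot g e.
Proof.
move=> f2 g2 e2; rewrite -RintegralD//; [|exact: integrable_rdot..].
by apply: eq_Rintegral => x _; rewrite /= !cE; ring.
Qed.

Lemma rdotNl f g : L2per f -> L2per g -> rdot (fun x => - f x) g = - rdot f g.
Proof.
move=> f2 g2; rewrite -mulN1r -RintegralZl//; last exact: integrable_rdot.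
by apply: eq_Rintegral => x _; rewrite /= !cE; ring.
Qed.

Lemma rdot_mul_i f : rdot f (fun x => 'i%C * f x) = 0.
Proof.
rewrite /rdot (@eq_Rintegral _ _ _ _ _ (cst 0)) ?Rintegral_cst ?mul0r//.
by move=> x _; rewrite !cE/=; ring.
Qed.

Lemma rdot_ge0 f : 0 <= rdot f f.
Proof. by apply: Rintegral_ge0 => x _; rewrite -!expr2 addr_ge0 ?sqr_ge0. Qed.

Lemma L2perN f : L2per f -> L2per (fun x => - f x).
Proof.
move=> /L2per_mul_i/L2per_mul_i; congr L2per; apply/funext => x.
by rewrite mulrA -expr2 complex.sqr_i mulN1r.
Qed.

Lemma L2perD f g : L2per f -> L2per g -> L2per (f \+ g).
Proof.
move=> f2 g2; have [fr fi] := L2per_sq_integrable f2.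
have [gr gi] := L2per_sq_integrable g2.
have mI : measurable (`]- L, L[ : set (measurableTypeR R)) by [].
have [mr ir] := sq_integrableD mI fr gr.
have [mi ii] := sq_integrableD mI fi gi.
split.
- by move=> x /=; case: f2 => -> _ _ _; case: g2 => -> _ _ _.
- by under eq_fun do rewrite ReD.
- by under eq_fun do rewrite ImD.
rewrite /sqnormI /Itv.
under eq_integral do rewrite normc_sqr !cE EFinD.
rewrite ge0_integralD//; first exact: lte_add_pinfty.
- by move=> x _; rewrite lee_fin sqr_ge0.
- by apply/measurable_EFinP/measurable_funTS; exact: measurable_funX.
- by move=> x _; rewrite lee_fin sqr_ge0.
- by apply/measurable_EFinP/measurable_funTS; exact: measurable_funX.
Qed.

Lemma L2perB f g : L2per f -> L2per g -> L2per (f \- g).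
Proof. by move=> f2 g2; apply: L2perD => //; exact: L2perN. Qed.

Lemma rdotBl f g e : L2per f -> L2per g -> L2per e -> rdot (f \- g) e = rdot f e - rdot g e.
Proof. by move=> f2 g2 e2; rewrite -rdotNl// -rdotDl//; exact: L2perN. Qed.

Lemma rdotDr f g e : L2per f -> L2per g -> L2per e -> rdot e (f \+ g) = rdot e f + rdot e g.
Proof. by move=> f2 g2 e2; rewrite rdotC rdotDl// !(rdotC e). Qed.

Lemma rdotBr f g e : L2per f -> L2per g -> L2per e -> rdot e (f \- g) = rdot e f - rdot e g.
Proof. by move=> f2 g2 e2; rewrite rdotC rdotBl// !(rdotC e). Qed.

Lemma l2norm_ge0 f : 0 <= l2norm f. Proof. exact: sqrtr_ge0. Qed.

Lemma sqr_l2norm f : l2norm f ^+ 2 = rdot f f.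
Proof. by rewrite sqr_sqrtr// rdot_ge0. Qed.

Lemma rdot_le f g : L2per f -> L2per g -> `|rdot f g| <= l2norm f * l2norm g.
Proof.
move=> f2 g2; rewrite -(@ler_pXn2r _ 2)// ?nnegrE ?mulr_ge0 ?l2norm_ge0//.
rewrite real_normK ?num_real// exprMn !sqr_l2norm.
apply: cauchy_schwarz_Rintegral => //; [exact: integrable_rdot..| |].
  by move=> x; rewrite -!expr2 addr_ge0 ?sqr_ge0.
move=> x t.
have := addr_ge0 (sqr_ge0 (Re (f x) + t * Re (g x))) (sqr_ge0 (Im (f x) + t * Im (g x))).
by congr (_ <= _); ring.
Qed.

Lemma l2normD f g : L2per f -> L2per g -> l2norm (f \+ g) <= l2norm f + l2norm g.
Proof.
move=> f2 g2; rewrite -(@ler_pXn2r _ 2)// ?nnegrE ?addr_ge0 ?l2norm_ge0//.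
have fg2 := L2perD f2 g2.
rewrite sqr_l2norm rdotDl// !rdotDr// (rdotC g f) sqrrD !sqr_l2norm.
have := le_trans (ler_norm _) (rdot_le f2 g2).
by rewrite mulr2n; lra.
Qed.

Lemma l2norm_mul_i f : l2norm (fun x => 'i%C * f x) = l2norm f.
Proof. by congr Num.sqrt; apply: eq_Rintegral => x _; rewrite !cE; ring. Qed.

Lemma l2normN f : l2norm (fun x => - f x) = l2norm f.
Proof. by congr Num.sqrt; apply: eq_Rintegral => x _; rewrite !cE; ring. Qed.

Lemma l2normB f g : L2per f -> L2per g -> l2norm (f \- g) <= l2norm f + l2norm g.
Proof. by move=> f2 g2; rewrite -(l2normN g); apply: l2normD => //; exact: L2perN. Qed.

Lemma sqnormI_shift f h : L2per f -> sqnormI L (fun x => f (x + h)) = sqnormI L f.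
Proof.
move=> [pf mr mi _].
apply: (@ge0_integral_itv_oo_shift _ (fun x => (normc (f x) ^+ 2)%:E)) => //.
- by move=> x; rewrite pf.
- exact: measurable_normc_sqr.
- by move=> x; rewrite lee_fin sqr_ge0.
Qed.

Lemma L2per_shift f h : L2per f -> L2per (fun x => f (x + h)).
Proof.
move=> f2; have [pf mr mi fin] := f2; split; last by rewrite sqnormI_shift.
- by move=> x; rewrite addrAC pf.
- by apply: (measurableT_comp mr); exact: measurable_shift.
- by apply: (measurableT_comp mi); exact: measurable_shift.
Qed.

(** Translation invariance over a period is available for nonnegative integrands, hence for squared
    norms; polarization carries it over to [rdot]. *)
Lemma rdot_polarization f g : L2per f -> L2per g ->
  rdot f g = (rdot (f \+ g) (f \+ g) - rdot (f \- g) (f \- g)) / 4.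
Proof.
move=> f2 g2; have fg2 := L2perD f2 g2; have fg2' := L2perB f2 g2.
rewrite (rdotDl f2 g2 fg2) (rdotDr f2 g2 f2) (rdotDr f2 g2 g2).
by rewrite (rdotBl f2 g2 fg2') (rdotBr f2 g2 f2) (rdotBr f2 g2 g2) (rdotC g f); field.
Qed.

Lemma rdot_shift f g h : L2per f -> L2per g ->
  rdot (fun x => f (x + h)) (fun x => g (x + h)) = rdot f g.
Proof.
move=> f2 g2.
have H e : L2per e -> rdot (fun x => e (x + h)) (fun x => e (x + h)) = rdot e e.
  move=> e2; apply: EFin_inj; rewrite -!sqnormIE ?sqnormI_shift//.
  exact: L2per_shift.
rewrite rdot_polarization; [|exact: L2per_shift..].
by rewrite [RHS]rdot_polarization// (H (f \+ g) (L2perD f2 g2)) (H (f \- g) (L2perB f2 g2)).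
Qed.

End L2per.

(** * Weak derivatives *)

Section WeakDerivative.
Context {R : realType}.
Local Notation mu := (@lebesgue_measure R).
Local Notation Re := complex.Re.
Local Notation Im := complex.Im.
Local Notation normc := ComplexField.Normc.normc.
Implicit Types (f g e : R -> R[i]) (z : R[i]).
Context (L : R) (L_gt0 : 0 < L).

(** Keeps the weak derivative as explicit data: sums, differences and translates of pairs are again
    pairs, whereas [wderiv] respects these operations only up to null sets. *)
Definition H1pair f g := periodic f (L *+ 2) /\ weak_derivative L f g.

Lemma H1pair_L2per f g : H1pair f g -> L2per L g.
Proof. by case=> _ []. Qed.

Lemma weak_derivative_Re f g a b : weak_derivative L f g -> a <= b ->
  Re (f b) - Re (f a) = \int[mu]_(x in `[a, b]) Re (g x).
Proof. by case=> _ _ _ _ H ab; rewrite -ReN -ReD H. Qed.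

Lemma weak_derivative_Im f g a b : weak_derivative L f g -> a <= b ->
  Im (f b) - Im (f a) = \int[mu]_(x in `[a, b]) Im (g x).
Proof. by case=> _ _ _ _ H ab; rewrite -ImN -ImD H. Qed.

Lemma complexP (z w : R[i]) : Re z = Re w -> Im z = Im w -> z = w.
Proof. by case: z => a b; case: w => c d /= -> ->. Qed.

Lemma L2per_integrable_Re g a b : L2per L g ->
  mu.-integrable `[a, b] (EFin \o (fun x => Re (g x))).
Proof.
move=> g2; apply: sq_integrable_integrable1 => //.
  exact: lebesgue_measure_itv_lty.
exact: (L2per_sq_integrable_Re L_gt0).
Qed.

Lemma L2per_integrable_Im g a b : L2per L g ->
  mu.-integrable `[a, b] (EFin \o (fun x => Im (g x))).
Proof.
move=> g2; apply: sq_integrable_integrable1 => //.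
  exact: lebesgue_measure_itv_lty.
exact: (L2per_sq_integrable_Im L_gt0).
Qed.

Lemma H1pairD f1 g1 f2 g2 : H1pair f1 g1 -> H1pair f2 g2 ->
  H1pair (f1 \+ f2) (g1 \+ g2).
Proof.
move=> h1 h2; have l1 := H1pair_L2per h1; have l2 := H1pair_L2per h2.
have [p m1 m2 fin] := L2perD L_gt0 l1 l2.
case: h1 h2 => [p1 w1] [p2 w2]; split; first by move=> x /=; rewrite p1 p2.
split => // a b ab; apply: complexP.
- rewrite /cintegral /= !cE.
  under eq_Rintegral do rewrite ReD.
  rewrite RintegralD//; [|exact: L2per_integrable_Re..].
  by rewrite -(weak_derivative_Re w1)// -(weak_derivative_Re w2)//; ring.
- rewrite /cintegral /= !cE.
  under eq_Rintegral do rewrite ImD.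
  rewrite RintegralD//; [|exact: L2per_integrable_Im..].
  by rewrite -(weak_derivative_Im w1)// -(weak_derivative_Im w2)//; ring.
Qed.

Lemma H1pairN f g : H1pair f g -> H1pair (fun x => - f x) (fun x => - g x).
Proof.
move=> h; have l := H1pair_L2per h.
have [p m1 m2 fin] := L2perN l.
case: h => [pf w]; split; first by move=> x /=; rewrite pf.
split => // a b ab; apply: complexP.
- rewrite /cintegral /= !cE.
  under eq_Rintegral do rewrite ReN -mulN1r.
  rewrite RintegralZl//; last exact: L2per_integrable_Re.
  by rewrite -(weak_derivative_Re w)//; ring.
- rewrite /cintegral /= !cE.
  under eq_Rintegral do rewrite ImN -mulN1r.
  rewrite RintegralZl//; last exact: L2per_integrable_Im.
  by rewrite -(weak_derivative_Im w)//; ring.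
Qed.

Lemma H1pairB f1 g1 f2 g2 : H1pair f1 g1 -> H1pair f2 g2 ->
  H1pair (f1 \- f2) (g1 \- g2).
Proof. by move=> h1 h2; apply: H1pairD => //; exact: H1pairN. Qed.

Lemma Rintegral_shift_itv (u : R -> R) (h a b : R) : measurable_fun [set: R] u ->
  \int[mu]_(x in `[a, b]) u (x + h) = \int[mu]_(x in `[a + h, b + h]) u x.
Proof.
move=> mu_; congr fine.
rewrite -(@integral_shift _ (fun x => (u x)%:E) h)//; last exact/measurable_EFinP.
congr (integral _ _ _).
by apply/seteqP; split => x /=; rewrite !in_itv/= !lerD2r.
Qed.

Lemma H1pair_shift f g h : H1pair f g ->
  H1pair (fun x => f (x + h)) (fun x => g (x + h)).
Proof.
move=> hfg; have [p m1 m2 fin] := L2per_shift L_gt0 h (H1pair_L2per hfg).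
have [_ m3 m4 _] := H1pair_L2per hfg.
case: hfg => [pf w]; split; first by move=> x /=; rewrite addrAC pf.
split => // a b ab; apply: complexP; rewrite /cintegral /= !cE.
- rewrite (@Rintegral_shift_itv (fun x => Re (g x)))// -(weak_derivative_Re w)//.
  by rewrite lerD2r.
- rewrite (@Rintegral_shift_itv (fun x => Im (g x)))// -(weak_derivative_Im w)//.
  by rewrite lerD2r.
Qed.

Lemma integrable_normc_sqr g a b : L2per L g ->
  mu.-integrable `[a, b] (EFin \o (fun x => normc (g x) ^+ 2)).
Proof.
move=> g2; apply/integrableP; have [_ mr mi _] := g2; split.
  by apply: measurable_funTS; exact: measurable_normc_sqr.
under eq_integral do rewrite /= ger0_norm ?sqr_ge0//.
exact: (L2per_itv_lty L_gt0 a b g2).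
Qed.

(** Cauchy-Schwarz against the constant 1, applied to the real and imaginary parts of [f b - f a]
    written as integrals of [g]. *)
Lemma H1pair_le f g a b : H1pair f g -> a <= b ->
  normc (f b - f a) ^+ 2 <= (b - a) * \int[mu]_(x in `[a, b]) (normc (g x) ^+ 2).
Proof.
move=> hfg ab; have g2 := H1pair_L2per hfg; case: hfg => _ w.
have ir := L2per_sq_integrable_Re L_gt0 a b g2.
have ii := L2per_sq_integrable_Im L_gt0 a b g2.
under eq_Rintegral do rewrite normc_sqr.
rewrite RintegralD//; [|exact: sq_integrable_integrable..].
rewrite normc_sqr !cE (weak_derivative_Re w)// (weak_derivative_Im w)// mulrDr.
by apply: lerD; exact: sqr_Rintegral_le.
Qed.

Lemma Rintegral_normc_sqr_le g a b : L2per L g -> a <= b -> b <= a + L *+ 2 ->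
  \int[mu]_(x in `[a, b]) (normc (g x) ^+ 2) <= rdot L g g.
Proof.
move=> g2 ab ba; have [pf mr mi fin] := g2.
have mk := measurable_normc_sqr mr mi.
have k0 x : (0 <= (normc (g x) ^+ 2)%:E)%E by rewrite lee_fin sqr_ge0.
rewrite -lee_fin -(sqnormIE L_gt0 g2) /Rintegral fineK; last first.
  by apply: integrable_fin_num => //; exact: integrable_normc_sqr.
rewrite -(@integral_itv_obnd_cbnd _ a); last exact: measurable_funTS.
have L2 : 0 < L *+ 2 by rewrite pmulrn_lgt0.
have kp x : ((normc (g (x + L *+ 2)) ^+ 2)%:E = (normc (g x) ^+ 2)%:E)%E by rewrite pf.
apply: (@le_trans _ _ (\int[mu]_(x in `]a, (a + L *+ 2)%R]) (normc (g x) ^+ 2)%:E)%E).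
  apply: ge0_subset_integral => //; first exact: measurable_funTS.
  by apply: subset_itvl; rewrite bnd_simp.
rewrite (ge0_integral_period a (- L) L2 kp mk k0).
have -> : - L + L *+ 2 = L by ring.
by rewrite -integral_itv_bndo_bndc//; exact: measurable_funTS.
Qed.

(** The restriction to one period lets the integral of |g|^2 between [a] and [b] be bounded by its
    integral over a single period. *)
Lemma H1pair_holder f g a b : H1pair f g -> `|b - a| <= L *+ 2 ->
  normc (f b - f a) ^+ 2 <= `|b - a| * rdot L g g.
Proof.
move=> hfg; wlog ab : a b / a <= b.
  move=> H; have [/H//|/ltW/H] := leP a b.
  rewrite (distrC a b) (_ : normc (f a - f b) ^+ 2 = normc (f b - f a) ^+ 2)//.
  by rewrite !normc_sqr !cE; ring.
rewrite ger0_norm ?subr_ge0// lerBlDl => ba.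
apply: le_trans (H1pair_le hfg ab) _; rewrite ler_wpM2l ?subr_ge0//.
by apply: Rintegral_normc_sqr_le => //; exact: H1pair_L2per hfg.
Qed.

End WeakDerivative.

(** * Continuity, Sobolev embedding and translation estimate *)

Section H1pairEstimates.
Context {R : realType}.
Local Notation mu := (@lebesgue_measure R).
Local Notation Re := complex.Re.
Local Notation Im := complex.Im.
Local Notation normc := ComplexField.Normc.normc.
Implicit Types (f g e : R -> R[i]) (z : R[i]).
Context (L : R) (L_gt0 : 0 < L).
Local Notation H1pair := (H1pair L).
Local Notation L2per := (L2per L).

Lemma Re_sqr_le_normc z : Re z ^+ 2 <= normc z ^+ 2.
Proof. by rewrite normc_sqr lerDl sqr_ge0. Qed.

Lemma Im_sqr_le_normc z : Im z ^+ 2 <= normc z ^+ 2.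
Proof. by rewrite normc_sqr lerDr sqr_ge0. Qed.

Lemma holder_half_continuous (u : R -> R) (C d : R) : 0 < d ->
  (forall a b, `|b - a| <= d -> (u b - u a) ^+ 2 <= `|b - a| * C) ->
  continuous u.
Proof.
move=> d0 H x; apply/cvgrPdist_lt => /= e e0.
pose r := Num.min d (e ^+ 2 / (`|C| + 1)).
have C1 : 0 < `|C| + 1 by rewrite ltr_wpDl.
have r0 : 0 < r by rewrite lt_min d0 divr_gt0// exprn_gt0.
exists r => //= y; rewrite /ball_/= => xy.
have [xyd xye] : `|x - y| <= d /\ `|x - y| < e ^+ 2 / (`|C| + 1).
  by move: xy; rewrite /r lt_min => /andP[/ltW].
rewrite -(@ltr_pXn2r _ 2)// ?nnegrE ?(ltW e0)// real_normK ?num_real//.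
apply: le_lt_trans (H y x xyd) _; move: xye; rewrite ltr_pdivlMr//.
have := ler_norm C; have := normr_ge0 (x - y); nra.
Qed.

Lemma H1pair_continuous_Re f g : H1pair f g -> continuous (fun x => Re (f x)).
Proof.
move=> hfg; apply: (@holder_half_continuous _ (rdot L g g) (L *+ 2)).
  by rewrite pmulrn_lgt0.
move=> a b ab; have := H1pair_holder L_gt0 hfg ab; apply: le_trans.
by have := Re_sqr_le_normc (f b - f a); rewrite !cE.
Qed.

Lemma H1pair_continuous_Im f g : H1pair f g -> continuous (fun x => Im (f x)).
Proof.
move=> hfg; apply: (@holder_half_continuous _ (rdot L g g) (L *+ 2)).
  by rewrite pmulrn_lgt0.
move=> a b ab; have := H1pair_holder L_gt0 hfg ab; apply: le_trans.
by have := Im_sqr_le_normc (f b - f a); rewrite !cE.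
Qed.

Lemma lebesgue_measure_period : mu `]- L, L[ = (L *+ 2)%:E.
Proof.
rewrite lebesgue_measure_itv/= lte_fin gtrN// -EFinB.
by congr EFin; ring.
Qed.

Lemma bounded_L2per f (B : R) : periodic f (L *+ 2) ->
  measurable_fun [set: R] (fun x => Re (f x)) ->
  measurable_fun [set: R] (fun x => Im (f x)) ->
  (forall x, x \in `]- L, L[ -> normc (f x) ^+ 2 <= B) -> L2per f.
Proof.
move=> pf mr mi bf; split => //.
apply: (@le_lt_trans _ _ (\int[mu]_(x in `](- L)%R, L[) cst B%:E x)%E).
  rewrite /sqnormI /Itv; apply: ge0_le_integral => //.
  - by move=> x _; rewrite lee_fin sqr_ge0.
  - by apply: measurable_funTS; exact: measurable_normc_sqr.
by rewrite integral_cst// [X in (_ * X)%E]lebesgue_measure_period -EFinM ltry.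
Qed.

Lemma normc_sqrD z (w : R[i]) : normc (z + w) ^+ 2 <= 2 * normc z ^+ 2 + 2 * normc w ^+ 2.
Proof.
by rewrite !normc_sqr !cE; have := sqr_ge0 (Re z - Re w); have := sqr_ge0 (Im z - Im w); nra.
Qed.

(** Finiteness comes from a pointwise bound: each point of []- L, L[] is within distance [L] of 0,
    so the Holder estimate controls [f x - f 0]. *)
Lemma H1pair_L2per_fst f g : H1pair f g -> L2per f.
Proof.
move=> hfg; apply: (@bounded_L2per _ (2 * (L * rdot L g g) + 2 * normc (f 0) ^+ 2)).
- by case: hfg.
- by apply: continuous_measurable_fun; exact: H1pair_continuous_Re hfg.
- by apply: continuous_measurable_fun; exact: H1pair_continuous_Im hfg.
move=> x; rewrite in_itv/= => xI; rewrite -{1}(subrK (f 0) (f x)).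
apply: le_trans (normc_sqrD _ _) _; rewrite lerD2r ler_wpM2l//.
have xL : `|x - 0| <= L by rewrite subr0 ler_norml; case/andP: xI => /ltW -> /ltW ->.
apply: le_trans (H1pair_holder L_gt0 hfg _) _.
  by apply: le_trans xL _; rewrite mulr2n lerDl ltW.
by apply: ler_wpM2r xL; exact: rdot_ge0.
Qed.

(** A translation moves [x] to 0. For [y] in []- L, L[] the Holder estimate gives |f 0|^2 <= 2 |f
    y|^2 + 2 L ||g||^2; averaging over [y] yields |f 0|^2 <= ||f||^2 / L + 2 L ||g||^2, whence the
    constant. *)
Lemma sobolev_embedding f g x : H1pair f g ->
  normc (f x) ^+ 2 <= (L^-1 + 2 * L) * (rdot L f f + rdot L g g).
Proof.
move=> hfg0.
have hfg := H1pair_shift L_gt0 x hfg0.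
rewrite -(rdot_shift L_gt0 x (H1pair_L2per_fst hfg0) (H1pair_L2per_fst hfg0)).
rewrite -(rdot_shift L_gt0 x (H1pair_L2per hfg0) (H1pair_L2per hfg0)).
rewrite (_ : f x = f (0 + x)); last by rewrite add0r.
move: hfg; set f1 := fun y => f (y + x); set g1 := fun y => g (y + x) => hfg.
rewrite (_ : f (0 + x) = f1 0)//.
have f2 := H1pair_L2per_fst hfg.
have g0 := rdot_ge0 L g1; have f0 := rdot_ge0 L f1.
have key : normc (f1 0) ^+ 2 * (L *+ 2) <= 2 * rdot L f1 f1 + 2 * (L * rdot L g1 g1) * (L *+ 2).
  have E (c : R) : \int[mu]_(y in `]- L, L[) cst c y = c * (L *+ 2).
    by rewrite Rintegral_cst// [X in fine X]lebesgue_measure_period.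
  rewrite -!E /rdot -RintegralZl//; last exact: (integrable_rdot L_gt0 f2 f2).
  rewrite -RintegralD//; last 2 first.
  - have ii := integrable_rdot L_gt0 f2 f2.
    have mI : measurable (`]- L, L[ : set (measurableTypeR R)) by [].
    exact: (integrableZl mI 2 ii).
  - by apply: integrable_cst_lty => //; rewrite [X in (X < _)%E]lebesgue_measure_period ltry.
  apply: le_Rintegral => //.
  - by apply: integrable_cst_lty => //; rewrite [X in (X < _)%E]lebesgue_measure_period ltry.
  - have ii := integrable_rdot L_gt0 f2 f2.
    have mI : measurable (`]- L, L[ : set (measurableTypeR R)) by [].
    have cfin : (mu `](- L)%R, L[ < +oo)%E by rewrite [X in (X < _)%E]lebesgue_measure_period ltry.
    exact: (integrableD mI (integrableZl mI 2 ii) (integrable_cst_lty _ mI cfin)).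
  move=> y yI /=.
  rewrite -!expr2 -normc_sqr -{1}(subrK (f1 y) (f1 0)).
  apply: le_trans (normc_sqrD _ _) _; rewrite addrC lerD2l ler_wpM2l//.
  have yL : `|0 - y| <= L.
    by move: yI; rewrite sub0r normrN ler_norml /= in_itv/= => /andP[/ltW -> /ltW ->].
  apply: le_trans (H1pair_holder L_gt0 hfg _) _.
    by apply: le_trans yL _; rewrite mulr2n lerDl ltW.
  by rewrite ler_wpM2r.
have -> : L^-1 + 2 * L = (1 + 2 * L ^+ 2) / L by field; rewrite gt_eqF.
rewrite mulrAC ler_pdivlMr//; move: key; rewrite mulr2n.
have := normc_sqr (f1 0); have := sqr_ge0 L; have := mulr_ge0 (sqr_ge0 L) f0; nra.
Qed.

(** |f (x + h) - f x|^2 is at most [h] times the integral of |g (x + s)|^2 over [s] in []0, h]].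
    Integrate in [x] and exchange the integrals by Tonelli: for each [s] the inner integral is
    ||g||^2 by periodicity, and [s] contributes the second factor [h]. Unlike the Holder estimate,
    this is not limited to one period. *)
Lemma H1pair_translation f g h : H1pair f g -> 0 <= h ->
  rdot L (fun x => f (x + h) - f x) (fun x => f (x + h) - f x) <= h ^+ 2 * rdot L g g.
Proof.
move=> hfg h0.
have fh2 : L2per (fun x => f (x + h) - f x).
  exact: (L2perB L_gt0 (L2per_shift L_gt0 h (H1pair_L2per_fst hfg)) (H1pair_L2per_fst hfg)).
have g2 := H1pair_L2per hfg; have [pg mr mi fin] := g2.
have mk := measurable_normc_sqr mr mi.
have k0 x : (0 <= (normc (g x) ^+ 2)%:E)%E by rewrite lee_fin sqr_ge0.
rewrite -lee_fin EFinM -!sqnormIE//.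
have mind (i : interval R) : measurable_fun [set: R] (fun s : R => (\1_([set` i] : set R) s : R)%:E).
  by apply/measurable_EFinP; exact: measurable_indic.
(* Both domains are built in as indicators, so that Tonelli applies on the whole plane. *)
pose K (z : R * R) : \bar R :=
  ((normc (g (z.1 + z.2)) ^+ 2)%:E * (\1_(`]0, h] : set R) z.2)%:E *
   (\1_(`]- L, L[ : set R) z.1)%:E)%E.
have K0 (z : R * R) : (0 <= K z)%E by rewrite !mule_ge0// lee_fin.
have mK : measurable_fun [set: measurableTypeR R * measurableTypeR R] K.
  apply: emeasurable_funM; first apply: emeasurable_funM.
  - apply: (measurableT_comp mk).
    by apply: measurable_funD; [exact: measurable_fst|exact: measurable_snd].
  - apply/measurable_EFinP; apply: (measurableT_comp _ measurable_snd).
    exact: measurable_indic.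
  - apply/measurable_EFinP; apply: (measurableT_comp _ measurable_fst).
    exact: measurable_indic.
have mks x : measurable_fun [set: R] (fun s => (normc (g (x + s)) ^+ 2)%:E).
  apply: (measurableT_comp mk); apply: measurable_funD => //; exact: measurable_id.
have mks' x : measurable_fun [set: R] (fun s => (normc (g (s + x)) ^+ 2)%:E).
  by apply: (measurableT_comp mk); exact: measurable_shift.
have inner x : (\int[mu]_s K (x, s) =
    (\int[mu]_(s in `]0%R, h]) (normc (g (x + s)) ^+ 2)%:E) * (\1_(`](- L)%R, L[ : set R) x)%:E)%E.
  rewrite [in RHS]integral_mkcond epatch_indic -ge0_integralZr//.
  - by apply: emeasurable_funM; [exact: mks|exact: mind].
  - by move=> s _; rewrite mule_ge0// lee_fin.
apply: (@le_trans _ _ (h%:E * \int[mu]_x \int[mu]_s K (x, s))%E).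
  have mF : measurable_fun [set: R] (fun x => \int[mu]_s K (x, s))%E.
    exact: (@measurable_fun_fubini_tonelli_F _ _ _ _ _ mu _ mK).
  have F0 x : (0 <= \int[mu]_s K (x, s))%E by apply: integral_ge0 => s _.
  rewrite -ge0_integralZl//.
  rewrite /sqnormI /Itv [leLHS]integral_mkcond; apply: ge0_le_integral => //.
  - by move=> x _; rewrite erestrict_ge0// => y _; rewrite lee_fin sqr_ge0.
  - apply/(measurable_restrictT _ _).1 => //; apply: measurable_funTS.
    by apply: measurable_normc_sqr; case: fh2.
  - by apply: emeasurable_funM => //; exact: measurable_cst.
  move=> x _; rewrite patchE; case: ifPn => [xI|_]; last by rewrite mule_ge0// lee_fin.
  rewrite inner indicE xI mule1.
  have xh : x <= x + h by rewrite lerDl.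
  apply: (@le_trans _ _ ((x + h - x) * \int[mu]_(s in `[x, x + h]) (normc (g s) ^+ 2))%:E).
    by rewrite lee_fin; exact: (H1pair_le L_gt0 hfg xh).
  have -> : x + h - x = h by ring.
  rewrite EFinM; apply: lee_wpmul2l => //.
  rewrite /Rintegral fineK; last first.
    by apply: integrable_fin_num => //; exact: (integrable_normc_sqr L_gt0).
  rewrite -(@integral_itv_obnd_cbnd _ x); last exact: measurable_funTS.
  have := @ge0_integral_shift_itv _ (fun s => (normc (g s) ^+ 2)%:E) x 0 h mk k0.
  rewrite add0r (addrC h) => <-.
  by under eq_integral do rewrite addrC.
rewrite expr2 EFinM -muleA; apply: lee_wpmul2l => //.
have outer s : (\int[mu]_x K (x, s) = sqnormI L g * (\1_(`]0%R, h] : set R) s)%:E)%E.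
  rewrite -(sqnormI_shift L_gt0 s g2) /sqnormI /Itv [in RHS]integral_mkcond epatch_indic.
  rewrite -ge0_integralZr//.
  - by apply: eq_integral => x _; rewrite /K /= muleAC.
  - by apply: emeasurable_funM; [exact: mks'|exact: mind].
  - by move=> x _; rewrite mule_ge0// lee_fin.
rewrite fubini_tonelli//.
under eq_integral do rewrite outer.
rewrite ge0_integralZl//; first last.
- by apply: integral_ge0 => x _; rewrite lee_fin sqr_ge0.
- exact: mind.
rewrite integral_indic// setIT muleC; apply: lee_wpmul2r.
  by apply: integral_ge0 => x _; rewrite lee_fin sqr_ge0.
rewrite [X in (X <= _)%E](_ : _ = mu `]0%R, h]%classic)// lebesgue_measure_itv/=.
by case: ifP => _; rewrite ?oppr0 ?adde0 ?lee_fin.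
Qed.

End H1pairEstimates.

(** * Difference quotients *)

Section DifferenceQuotients.
Context {R : realType}.
Local Notation mu := (@lebesgue_measure R).
Local Notation Re := complex.Re.
Local Notation Im := complex.Im.
Local Notation normc := ComplexField.Normc.normc.
Implicit Types (f g e : R -> R[i]) (z : R[i]).

(** Lebesgue differentiation of the integral of [phi], read along the steps 1/(n+1), since Fatou's
    lemma will be applied to a sequence. *)
Lemma ae_cvg_difference_quotient (phi F : R -> R) (a b : R) :
  mu.-integrable `[a, b] (EFin \o phi) ->
  (forall x y, a <= x -> x <= y -> y <= b ->
    F y - F x = \int[mu]_(t in `[x, y]) phi t) ->
  {ae mu, forall x, x \in `]a, b[ ->
    (fun n : nat => n.+1%:R * (F (x + n.+1%:R^-1) - F x)) @ \oo --> phi x}.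
Proof.
move=> iphi HF.
have mab : measurable (`[a, b] : set (measurableTypeR R)) by [].
(* Cutting [phi] off outside [[a, b]] makes it integrable on every [[a, y]], as the differentiation
   theorem requires. *)
have iphi' : mu.-integrable setT (EFin \o (phi \_ `[a, b])).
  by move/(integrable_mkcond _ mab): iphi; rewrite restrict_EFin.
have locphi := integrable_locally (measurable_itv _) iphi.
have iy (y : R) : mu.-integrable [set` Interval (BLeft a) (BRight y)] (EFin \o (phi \_ `[a, b])).
  by apply: integrableS iphi'.
have := FTC1 iy locphi; set G := (fun x => _).
have aeF := ae_filter_ringOfSetsType mu.
apply: filterS => x /= Hx; rewrite in_itv/= => /andP[ax xb].
have GE y : a <= y -> y <= b -> G y = F y - F a.
  move=> ay yb; rewrite HF// /G; apply: eq_Rintegral => t.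
  rewrite inE/= in_itv/= => /andP[at_ ty].
  by rewrite patchE mem_set//= in_itv/= at_ (le_trans ty yb).
have Hax : (a%:E < x%:E)%E by rewrite lte_fin.
have [dG] := Hx Hax; rewrite derive1E => DG.
have phix : (phi \_ `[a, b]) x = phi x by rewrite patchE mem_set//= in_itv/= !ltW.
rewrite phix in DG.
have : h^-1 *: (G (h *: 1 + x) - G x) @[h --> 0^'] --> phi x.
  by rewrite -DG; exact: dG.
move=> /cvgr_dnbhsP/(_ (fun n => n.+1%:R^-1)) H.
have {H} := H (conj (fun n => lt0r_neq0 (_ : 0 < n.+1%:R^-1)) (@cvg_harmonic R)).
have h0 n : (0 : R) < n.+1%:R^-1 by rewrite invr_gt0.
move=> /(_ h0).
apply: cvg_trans; apply: near_eq_cvg; near=> n.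
rewrite invrK /GRing.scale/= mulr1 (addrC _ x) GE; last 2 first.
- by rewrite (le_trans (ltW ax))// lerDl ltW.
- rewrite -lerBrDl; apply: ltW; near: n.
  have bx : 0 < b - x by rewrite subr_gt0.
  have /cvgrPdist_lt/(_ _ bx) := @cvg_harmonic R.
  by apply: filterS => n; rewrite sub0r normrN /= gtr0_norm.
rewrite GE ?ltW//; congr (_ * _); ring.
Unshelve. all: by end_near. Qed.

Context (L : R) (L_gt0 : 0 < L).
Local Notation H1pair := (H1pair L).
Local Notation L2per := (L2per L).

Lemma H1pair_ae_cvg f g : H1pair f g ->
  {ae mu, forall x, x \in `]- L, L[ ->
    (fun n : nat => n.+1%:R * (Re (f (x + n.+1%:R^-1)) - Re (f x))) @ \oo --> Re (g x) /\
    (fun n : nat => n.+1%:R * (Im (f (x + n.+1%:R^-1)) - Im (f x))) @ \oo --> Im (g x)}.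
Proof.
move=> hfg; have g2 := H1pair_L2per hfg; case: hfg => _ w.
have rcv := @ae_cvg_difference_quotient _ (fun x => Re (f x)) _ _ (L2per_integrable_Re L_gt0 (- L) L g2)
  (fun x y _ xy _ => weak_derivative_Re w xy).
have icv := @ae_cvg_difference_quotient _ (fun x => Im (f x)) _ _ (L2per_integrable_Im L_gt0 (- L) L g2)
  (fun x y _ xy _ => weak_derivative_Im w xy).
have aeF := ae_filter_ringOfSetsType mu.
by apply: filterS2 rcv icv => x rx ix xI; split; [exact: rx|exact: ix].
Qed.

(** Both derivatives are almost everywhere limits of the same difference quotients. *)
Lemma H1pair_unique f g1 g2 : H1pair f g1 -> H1pair f g2 ->
  {ae mu, forall x, x \in `]- L, L[ -> g1 x = g2 x}.
Proof.
move=> /H1pair_ae_cvg h1 /H1pair_ae_cvg h2.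
have aeF := ae_filter_ringOfSetsType mu.
apply: filterS2 h1 h2 => x h1 h2 xI; have [r1 i1] := h1 xI; have [r2 i2] := h2 xI.
by apply: complexP; [exact: cvg_unique r1 r2|exact: cvg_unique i1 i2].
Qed.

(** A converse to [H1pair_translation]: |g|^2 is almost everywhere the limit of squared difference
    quotients whose integrals are at most [B ^+ 2], and Fatou's lemma passes this bound to the
    limit. *)
Lemma l2norm_derivative_le f g B : H1pair f g -> 0 <= B ->
  (forall h, 0 < h -> l2norm L (fun x => f (x + h) - f x) <= h * B) ->
  l2norm L g <= B.
Proof.
move=> hfg B0 HB; have g2 := H1pair_L2per hfg.
have f2 := H1pair_L2per_fst L_gt0 hfg.
rewrite -(@ler_pXn2r _ 2)// ?nnegrE ?l2norm_ge0// sqr_l2norm -lee_fin -sqnormIE//.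
have [N [mN N0 HN]] := H1pair_ae_cvg hfg.
pose k (n : nat) (x : R) : \bar R := (n.+1%:R ^+ 2 * normc (f (x + n.+1%:R^-1) - f x) ^+ 2)%:E.
have fh2 n : L2per (fun x => f (x + n.+1%:R^-1) - f x).
  exact: (L2perB L_gt0 (L2per_shift L_gt0 _ f2) f2).
have mD : measurable (`](- L)%R, L[ `\` N : set (measurableTypeR R)) by exact: measurableD.
have mk n : measurable_fun [set: R] (k n).
  have [_ mr mi _] := fh2 n.
  have := measurable_normc_sqr mr mi => /measurable_EFinP mn.
  by apply/measurable_EFinP; apply: measurable_funM.
have k0 n x : (0 <= k n x)%E by rewrite lee_fin mulr_ge0// sqr_ge0.
have [_ mr mi _] := g2.
have mg := measurable_normc_sqr mr mi.
rewrite /sqnormI /Itv (ge0_negligible_integral mN)//; last 2 first.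
- exact: measurable_funTS.
- by move=> x _; rewrite lee_fin sqr_ge0.
rewrite [leLHS](_ : _ = \int[mu]_(x in `](- L)%R, L[ `\` N) limn_einf (k ^~ x))%E; last first.
  apply: eq_integral => x; rewrite inE => -[xI xN].
  have [||cr ci] := @contrapT (x \in `]- L, L[ ->
    (fun n : nat => n.+1%:R * (Re (f (x + n.+1%:R^-1)) - Re (f x))) @ \oo --> Re (g x) /\
    (fun n : nat => n.+1%:R * (Im (f (x + n.+1%:R^-1)) - Im (f x))) @ \oo --> Im (g x)).
  - by move=> H; apply: xN; exact: HN.
  - exact: xI.
  suff cv : k ^~ x @ \oo --> (normc (g x) ^+ 2)%:E by rewrite (cvg_limn_einf_sup cv).1.
  apply: cvg_EFin; first by apply: nearW.
  rewrite normc_sqr.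
  have -> : fine \o k ^~ x = (fun n : nat =>
      (n.+1%:R * (Re (f (x + n.+1%:R^-1)) - Re (f x))) ^+ 2 +
      (n.+1%:R * (Im (f (x + n.+1%:R^-1)) - Im (f x))) ^+ 2).
    by apply/funext => n /=; rewrite normc_sqr !cE; ring.
  by apply: cvgD; rewrite expr2; under eq_fun do rewrite expr2; exact: cvgM.
apply: le_trans (fatou mu mD _ _) _.
- by move=> n; exact: (measurable_funTS (mk n)).
- by move=> n x _.
have kB n : (\int[mu]_(x in `](- L)%R, L[ `\` N) k n x <= (B ^+ 2)%:E)%E.
  apply: (@le_trans _ _ (\int[mu]_(x in `](- L)%R, L[) k n x)%E).
    by apply: ge0_subset_integral => //; exact: (measurable_funTS (mk n)).
  rewrite /k.
  under eq_integral do rewrite EFinM.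
  rewrite ge0_integralZl//; last 2 first.
  - by apply: measurable_funTS; apply: measurable_normc_sqr; case: (fh2 n).
  - by move=> x _; rewrite lee_fin sqr_ge0.
  rewrite -[X in (_ * X)%E]/(sqnormI L (fun x => f (x + n.+1%:R^-1) - f x)) sqnormIE//.
  rewrite -EFinM lee_fin -sqr_l2norm -exprMn ler_pXn2r// ?nnegrE ?mulr_ge0 ?l2norm_ge0//.
  by rewrite -ler_pdivlMl// HB// invr_gt0.
rewrite limn_einf_lim; apply: lime_le; first exact: is_cvg_einfs.
apply: nearW => n; apply: le_trans (kB n).
by apply: ereal_inf_lbound; exists n => /=.
Qed.

End DifferenceQuotients.

(** * Energy estimate *)

Section Energy.
Context {R : realType}.
Local Notation Re := complex.Re.
Local Notation Im := complex.Im.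
Implicit Types (f g k : R -> R[i]) (nu t T : R).

(** [y] is assumed neither continuous nor differentiable. The set [A] of points reached with slope
    at most [c + eta] contains its supremum, and it could be prolonged beyond a supremum smaller
    than [b]. *)
Lemma local_slope_le (y : R -> R) (a b c : R) : a <= b ->
  (forall t, a <= t <= b -> forall eta, 0 < eta ->
    exists2 d, 0 < d & forall r s, r <= s -> `|r - t| < d -> `|s - t| < d ->
      y s - y r <= (c + eta) * (s - r)) ->
  y b - y a <= c * (b - a).
Proof.
move=> ab H; apply/ler_addgt0Pr => e e0.
(* Chosen so that [eta * (b - a) <= e]. *)
pose eta := e / (b - a + 1).
have ba1 : 0 < b - a + 1 by rewrite ltr_wpDl// subr_ge0.
have eta0 : 0 < eta by rewrite divr_gt0.
suff : y b - y a <= (c + eta) * (b - a).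
  move=> /le_trans; apply; rewrite mulrDl lerD2l /eta mulrAC ler_pdivrMr//.
  by rewrite ler_wpM2l ?(ltW e0)// lerDl.
pose A := [set t | a <= t <= b /\ y t - y a <= (c + eta) * (t - a)].
have Aa : A a by split; rewrite ?lexx ?ab// !subrr mulr0.
have ubA : ubound A b by move=> t [/andP[]].
have supA : has_sup A by split; [exists a|exists b].
have sb : sup A <= b by apply: ge_sup => //; exists a.
have as_ : a <= sup A by apply: ub_le_sup => //; exists b.
have [d d0 Hd] := H _ (introT andP (conj as_ sb)) _ eta0.
(* A point of [A] within [d] of the supremum, together with the slope bound between the two, puts
   the supremum in [A]. *)
have As : y (sup A) - y a <= (c + eta) * (sup A - a).
  have [t [/andP[at_ tb] yt] ts] := sup_adherent d0 supA.
  have tsup : t <= sup A by apply: ub_le_sup => //; [exists b|split => //; rewrite at_ tb].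
  have := Hd _ _ tsup; rewrite subrr normr0 => /(_ _ d0).
  rewrite ler0_norm ?subr_le0// opprB ltrBlDr addrC -ltrBlDr => /(_ ts).
  nra.
have [<-//|sltb] := eqVneq (sup A) b; exfalso.
have {}sltb : sup A < b by rewrite lt_neqAle sltb sb.
(* From the supremum one can advance by up to [d / 2] and remain in [A]. *)
pose t := Num.min b (sup A + d / 2).
have d2 : 0 < d / 2 by rewrite divr_gt0.
have d2d : d / 2 < d by rewrite ltr_pdivrMr// ltr_pMr// ltr1n.
have st : sup A < t by rewrite lt_min sltb/= ltrDl.
have tb : t <= b by rewrite ge_min lexx.
have td : `|t - sup A| < d.
  rewrite gtr0_norm ?subr_gt0// ltrBlDl; apply: le_lt_trans (_ : sup A + d / 2 < _).
    by rewrite ge_min lexx orbT.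
  by rewrite ltrD2l.
have := Hd _ _ (ltW st); rewrite subrr normr0 => /(_ d0 td) yst.
suff : A t by move=> /(ub_le_sup (ex_intro _ b ubA)); rewrite leNgt st.
by split; [rewrite (le_trans as_ (ltW st)) tb|nra].
Qed.

Lemma mean_value (G dG : R -> R) (a b : R) : a < b ->
  (forall q : R, a <= q -> is_derive q 1 G (dG q)) ->
  exists q : R, [/\ a < q, q < b & G b - G a = dG q * (b - a)].
Proof.
move=> ab GD; have [q||q] := @MVT _ G dG a b ab.
- by rewrite in_itv/= => /andP[aq _]; apply: GD; exact: ltW.
- apply: derivable_within_continuous => q; rewrite in_itv/= => /andP[aq _].
  by have [] := GD _ aq.
- by rewrite in_itv/= => /andP[aq qb] E; exists q.
Qed.

Context (L : R) (L_gt0 : 0 < L).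
Local Notation H1pair := (H1pair L).
Local Notation L2per := (L2per L).
Local Notation rdot := (rdot L).
Local Notation l2norm := (l2norm L).

Definition idot f g := rdot f (fun x => 'i%C * g x).

Lemma idotDr f g k : L2per f -> L2per g -> L2per k -> idot f (g \+ k) = idot f g + idot f k.
Proof.
move=> f2 g2 k2; rewrite /idot -rdotDr//; [|exact: L2per_mul_i..].
by congr rdot; apply/funext => x /=; rewrite mulrDr.
Qed.

Lemma idotBr f g k : L2per f -> L2per g -> L2per k -> idot f (g \- k) = idot f g - idot f k.
Proof.
move=> f2 g2 k2; rewrite /idot -rdotBr//; [|exact: L2per_mul_i..].
by congr rdot; apply/funext => x /=; rewrite mulrBr.
Qed.

Lemma idotBl f g k : L2per f -> L2per g -> L2per k -> idot (f \- g) k = idot f k - idot g k.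
Proof. by move=> f2 g2 k2; rewrite /idot rdotBl//; exact: L2per_mul_i. Qed.

Lemma idot_self f : idot f f = 0. Proof. exact: rdot_mul_i. Qed.

Lemma idot_le f g : L2per f -> L2per g -> `|idot f g| <= l2norm f * l2norm g.
Proof.
by move=> f2 g2; rewrite -(l2norm_mul_i L g); apply: rdot_le => //; exact: L2per_mul_i.
Qed.

Lemma idot_shift f g h : L2per f -> L2per g ->
  idot (fun x => f (x + h)) (fun x => g (x + h)) = idot f g.
Proof. by move=> f2 g2; rewrite /idot -[RHS](rdot_shift L_gt0 h)//; exact: L2per_mul_i. Qed.

Lemma l2norm_triangle f g k : L2per f -> L2per g -> L2per k ->
  l2norm (f \- g) <= l2norm (f \- k) + l2norm (g \- k).
Proof.
move=> f2 g2 k2; have -> : f \- g = (f \- k) \- (g \- k).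
  by apply/funext => x /=; ring.
by apply: l2normB => //; exact: L2perB.
Qed.

Lemma l2norm_leD f g : L2per f -> L2per g -> l2norm f <= l2norm g + l2norm (f \- g).
Proof.
move=> f2 g2; have {1}-> : f = g \+ (f \- g) by apply/funext => x /=; ring.
by apply: l2normD => //; exact: L2perB.
Qed.

(* The imaginary part of i w_t + nu w_xx + N = 0 tested against phi in H^1:
   idot is the imaginary part of the Hermitian product. *)
Definition forced_schroedinger nu (w wx N : R -> R -> R[i]) : Prop :=
  [/\ forall t, 0 <= t -> H1pair (w t) (wx t),
      forall t, 0 <= t -> L2per (N t),
      forall t, 0 <= t -> forall e : R, 0 < e -> exists2 d : R, 0 < d &
        forall s : R, 0 <= s -> `|s - t| < d ->
          l2norm (w s \- w t) <= e /\ l2norm (wx s \- wx t) <= e &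
      forall phi phix, H1pair phi phix -> forall t, 0 < t ->
        is_derive t 1 (fun s => rdot (w s) phi)
          (nu * idot (wx t) phix - idot (N t) phi)].

(* The principal part drops out because idot (wx r) (wx r) = 0 and wx is
   continuous in time; no time derivative of w is needed. *)
Lemma local_energy_slope nu (w wx N : R -> R -> R[i]) (B S : R) t : 0 < nu -> forced_schroedinger nu w wx N ->
  (forall s, 0 <= s -> l2norm (N s) <= B) -> 0 < t -> l2norm (w t) <= S ->
  forall eta, 0 < eta -> exists2 d, 0 < d & forall r s, r <= s ->
    `|r - t| < d -> `|s - t| < d ->
    rdot (w s) (w s) - rdot (w r) (w r) <= (2 * B * S + eta) * (s - r).
Proof.
move=> nu0 [hw hN hc hd] hB t0 hS eta eta0.
pose X := l2norm (wx t).
have X0 : 0 <= X := l2norm_ge0 _ _.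
have B0 : 0 <= B := le_trans (l2norm_ge0 _ _) (hB _ (ltW t0)).
have k0 : 0 < 4 * nu * (X + 1) + 2 * B + 1.
  by rewrite ltr_wpDl// addr_ge0// ?mulr_ge0// ?(ltW nu0)// addr_ge0.
(* The error terms below add up to [e * (4 * nu * (X + 1) + 2 * B)], which this [e] keeps below
   [eta]; [e <= 1] gives the bound [X + 1] on [wx q]. *)
pose e := Num.min 1 (eta / (4 * nu * (X + 1) + 2 * B + 1)).
have e0 : 0 < e by rewrite lt_min ltr01 divr_gt0.
have e1 : e <= 1 by rewrite ge_min lexx.
have eeta : e * (4 * nu * (X + 1) + 2 * B + 1) <= eta.
  by rewrite -ler_pdivlMr// ge_min lexx orbT.
have [d d0 Hd] := hc _ (ltW t0) _ e0.
(* The bound by [t] keeps both times positive, where the weak equation holds. *)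
exists (Num.min d t); first by rewrite lt_min d0.
have near_pos r : `|r - t| < Num.min d t -> 0 < r /\ `|r - t| < d.
  rewrite lt_min => /andP[rd rt]; split => //.
  by move: rt; rewrite ltr_distl subrr => /andP[].
move=> r s rs hr hs; have [r0 rd] := near_pos _ hr; have [s0 sd] := near_pos _ hs.
have [<-|rns] := eqVneq r s; first by rewrite !subrr mulr0.
have {rs} rs : r < s by rewrite lt_neqAle rns rs.
have wr := hw _ (ltW r0); have ws := hw _ (ltW s0); have wt := hw _ (ltW t0).
have wr2 := H1pair_L2per_fst L_gt0 wr; have ws2 := H1pair_L2per_fst L_gt0 ws.
have wt2 := H1pair_L2per_fst L_gt0 wt.
have wrx := H1pair_L2per wr; have wsx := H1pair_L2per ws; have wtx := H1pair_L2per wt.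
have hphi := H1pairD L_gt0 ws wr.
have phi2 := L2perD L_gt0 ws2 wr2.
pose G q := rdot (w q) (w s \+ w r).
pose dG q := nu * idot (wx q) (wx s \+ wx r) - idot (N q) (w s \+ w r).
have GD (q : R) : 0 < q -> is_derive q 1 G (dG q) by move=> q0; exact: hd hphi q q0.
have [q [rq qs GE]] := mean_value rs (fun q rq => GD q (lt_le_trans r0 rq)).
have q0 : 0 < q := lt_trans r0 rq.
have qd : `|q - t| < d.
  move: rd sd; rewrite !ltr_distl => /andP[r1 _] /andP[_ s2].
  by rewrite (lt_trans r1 rq) (lt_trans qs s2).
have wq := hw _ (ltW q0); have wqx := H1pair_L2per wq.
have -> : rdot (w s) (w s) - rdot (w r) (w r) = G s - G r.
  by rewrite /G !rdotDr// (rdotC _ (w r) (w s)); ring.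
rewrite GE ler_wpM2r ?subr_ge0 ?(ltW rs)//.
have [es1 es2] := Hd _ (ltW s0) sd; have [er1 er2] := Hd _ (ltW r0) rd.
have [eq1 eq2] := Hd _ (ltW q0) qd.
(* The mean value theorem yields an intermediate time [q]. Subtracting [wx q] from both terms is
   free, and what remains compares [wx] at times close to [t]. *)
have E1 : idot (wx q) (wx s \+ wx r) =
    idot (wx q) (wx s \- wx q) + idot (wx q) (wx r \- wx q).
  by rewrite idotDr// !idotBr// idot_self !subr0.
have Ns : l2norm (wx s \- wx q) <= 2 * e.
  by apply: le_trans (l2norm_triangle wsx wqx wtx) _; lra.
have Nr : l2norm (wx r \- wx q) <= 2 * e.
  by apply: le_trans (l2norm_triangle wrx wqx wtx) _; lra.
have Nq : l2norm (wx q) <= X + 1.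
  by apply: le_trans (l2norm_leD wqx wtx) _; rewrite lerD2l; exact: le_trans eq2 e1.
have I1 : idot (wx q) (wx s \- wx q) <= (X + 1) * (2 * e).
  apply: le_trans (le_trans (ler_norm _) (idot_le wqx (L2perB L_gt0 wsx wqx))) _.
  by apply: ler_pM => //; exact: l2norm_ge0.
have I2 : idot (wx q) (wx r \- wx q) <= (X + 1) * (2 * e).
  apply: le_trans (le_trans (ler_norm _) (idot_le wqx (L2perB L_gt0 wrx wqx))) _.
  by apply: ler_pM => //; exact: l2norm_ge0.
have Nphi : l2norm (w s \+ w r) <= 2 * (S + e).
  apply: le_trans (l2normD L_gt0 ws2 wr2) _.
  have := l2norm_leD ws2 wt2; have := l2norm_leD wr2 wt2; lra.
have I3 : - idot (N q) (w s \+ w r) <= B * (2 * (S + e)).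
  have := idot_le (hN _ (ltW q0)) phi2; rewrite ler_norml => /andP[I3 _].
  rewrite lerNl; apply: le_trans I3; rewrite lerN2.
  by apply: ler_pM => //; [exact: l2norm_ge0..|exact: hB (ltW q0)].
have I4 : nu * idot (wx q) (wx s \+ wx r) <= nu * ((X + 1) * (2 * e) + (X + 1) * (2 * e)).
  by rewrite ler_pM2l// E1; exact: lerD.
rewrite /dG; move: (lerD I4 I3) eeta (ltW e0) X0 B0.
by move=> /le_trans H1 H2 H3 H4 H5; apply: H1; nra.
Qed.

(* The supremum S of the norms on [0, T] satisfies
   S^2 <= ||w(0)||^2 + 2 B T S, whence S <= ||w(0)|| + 2 T B. *)
Lemma energy_estimate nu (w wx N : R -> R -> R[i]) (B S0 : R) T : 0 < nu -> forced_schroedinger nu w wx N ->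
  (forall t, 0 <= t -> l2norm (N t) <= B) -> (forall t, 0 <= t -> l2norm (w t) <= S0) ->
  0 <= T -> l2norm (w T) <= l2norm (w 0) + 2 * T * B.
Proof.
move=> nu0 hw hB hS0 T0.
have B0 : 0 <= B := le_trans (l2norm_ge0 _ _) (hB _ (lexx 0)).
pose A := [set l2norm (w t) | t in [set t | 0 <= t <= T]].
(* [S0] makes the supremum finite; its size does not enter the final bound, which comes from the
   quadratic inequality for [S]. *)
have ubA : has_ubound A by exists S0 => _ [t /andP[t0 _] <-]; exact: hS0.
have At t : 0 <= t -> t <= T -> l2norm (w t) <= sup A.
  by move=> t0 tT; apply: ub_le_sup => //; exists t => //=; rewrite t0.
set S := sup A in At.
have S_ge0 : 0 <= S := le_trans (l2norm_ge0 _ _) (At _ (lexx 0) T0).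
pose n0 := l2norm (w 0).
have n00 : 0 <= n0 := l2norm_ge0 _ _.
have [hw1 _ hc _] := hw.
have key t : 0 <= t -> t <= T -> l2norm (w t) ^+ 2 <= n0 ^+ 2 + 2 * B * S * T.
  rewrite le_eqVlt => /predU1P[<- _|t0 tT].
    by rewrite lerDl !mulr_ge0.
  apply/ler_addgt0Pr => e e0.
  (* This choice makes [(n0 + e') ^+ 2 <= n0 ^+ 2 + e]. *)
  pose e' := Num.min 1 (e / (2 * n0 + 1)).
  have n1 : 0 < 2 * n0 + 1 by rewrite ltr_wpDl// mulr_ge0.
  have e'0 : 0 < e' by rewrite lt_min ltr01 divr_gt0.
  have e'1 : e' <= 1 by rewrite ge_min lexx.
  have e'e : e' * (2 * n0 + 1) <= e by rewrite -ler_pdivlMr// ge_min lexx orbT.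
  have [d d0 Hd] := hc _ (lexx 0) _ e'0.
  (* The slope bound holds at positive times only: the estimate starts at a small [a > 0], and
     continuity at 0 compares [w a] with [w 0]. *)
  pose a := Num.min t (d / 2).
  have a0 : 0 < a by rewrite lt_min t0 divr_gt0.
  have at_ : a <= t by rewrite ge_min lexx.
  have ad : `|a - 0| < d.
    rewrite subr0 gtr0_norm// (@le_lt_trans _ _ (d / 2))// ?ge_min ?lexx ?orbT//.
    by rewrite ltr_pdivrMr// ltr_pMr// ltr1n.
  have [wa _] := Hd _ (ltW a0) ad.
  have Na : l2norm (w a) <= n0 + e'.
    have wa2 := H1pair_L2per_fst L_gt0 (hw1 _ (ltW a0)).
    have w02 := H1pair_L2per_fst L_gt0 (hw1 _ (lexx 0)).
    by apply: le_trans (l2norm_leD wa2 w02) _; rewrite lerD2l.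
  have sl : rdot (w t) (w t) - rdot (w a) (w a) <= 2 * B * S * (t - a).
    apply: (@local_slope_le (fun q => rdot (w q) (w q))) => // q /andP[aq qt] eta eta0.
    have q0 := lt_le_trans a0 aq.
    exact: (local_energy_slope nu0 hw hB q0 (At _ (ltW q0) (le_trans qt tT)) eta0).
  rewrite sqr_l2norm.
  have sl2 : 2 * B * S * (t - a) <= 2 * B * S * T.
    by rewrite ler_wpM2l ?mulr_ge0// lerBlDr (le_trans tT)// lerDl ltW.
  have na2 : rdot (w a) (w a) <= (n0 + e') ^+ 2.
    by rewrite -sqr_l2norm ler_pXn2r// ?nnegrE ?l2norm_ge0// addr_ge0// ltW.
  have sq : (n0 + e') ^+ 2 <= n0 ^+ 2 + e.
    have -> : (n0 + e') ^+ 2 = n0 ^+ 2 + e' * (2 * n0 + e') by ring.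
    by rewrite lerD2l (le_trans _ e'e)// ler_wpM2l ?(ltW e'0)// lerD2l.
  by rewrite -lerBlDr; lra.
have S2 : S ^+ 2 <= n0 ^+ 2 + 2 * B * S * T.
  have Q0 : 0 <= n0 ^+ 2 + 2 * B * S * T by rewrite addr_ge0 ?sqr_ge0// !mulr_ge0.
  rewrite -[leRHS]sqr_sqrtr// ler_pXn2r// ?nnegrE ?sqrtr_ge0//.
  apply: ge_sup; first by exists (l2norm (w 0)); exists 0 => //=; rewrite lexx.
  move=> _ [t /andP[t0 tT] <-].
  by apply: ler_wsqrtr; rewrite -sqr_l2norm key.
(* Otherwise both [S] and [S - 2 * T * B] exceed [n0], so their product exceeds [n0 ^+ 2], against
   [S2]. *)
apply: le_trans (At _ T0 (lexx T)) _; rewrite leNgt; apply/negP => lt1.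
have bt : 0 <= 2 * T * B by rewrite !mulr_ge0.
have lt2 : n0 < S by apply: le_lt_trans lt1; rewrite lerDl.
have lt3 : n0 < S - 2 * T * B by rewrite ltrBrDr.
have : n0 * n0 < S * (S - 2 * T * B) by apply: ltr_pM.
by move: S2; rewrite !expr2; lra.
Qed.

End Energy.

(** * Nonlinear terms *)

Section Nonlinearity.
Context {R : realType}.
Local Notation mu := (@lebesgue_measure R).
Local Notation Re := complex.Re.
Local Notation Im := complex.Im.
Local Notation normc := ComplexField.Normc.normc.
Implicit Types (f g : R -> R[i]) (z w : R[i]) (G : R -> R).

Definition nonlin G z : R[i] := (G (normc z ^+ 2))%:C%C * z.

(** [G] is evaluated at squared moduli, hence the range [[0, r ^+ 2]] for moduli up to [r]. *)
Definition lipschitz_upto G (Lam r : R) := forall a b,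
  0 <= a <= r ^+ 2 -> 0 <= b <= r ^+ 2 -> `|G a - G b| <= Lam * `|a - b|.

Lemma normc_ge0 z : 0 <= normc z.
Proof. by rewrite normc_eqE sqrtr_ge0. Qed.

Lemma normc_real (a : R) : normc a%:C%C = `|a|.
Proof. by rewrite normc_eqE /= expr0n/= addr0 sqrtr_sqr. Qed.

Lemma normc_le_dist z w : `|normc z - normc w| <= normc (z - w).
Proof.
rewrite ler_norml lerNl opprB !lerBlDr; apply/andP; split.
- have := le_normcD (w - z) z; rewrite subrK => /le_trans; apply.
  by rewrite -normcN opprB.
- by have := le_normcD (z - w) w; rewrite subrK.
Qed.

(** Split the difference into G(|z|^2) (z - w) and (G(|z|^2) - G(|w|^2)) w. The first costs
    [Lam * r ^+ 2] because [G 0 = 0], the second [Lam * (r + r) * r] by factoring |z|^2 - |w|^2;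
    this is the 3. *)
Lemma nonlin_lipschitz G (Lam r : R) z w :
  lipschitz_upto G Lam r ->
  G 0 = 0 -> normc z <= r -> normc w <= r ->
  normc (nonlin G z - nonlin G w) <= 3 * Lam * r ^+ 2 * normc (z - w).
Proof.
move=> HG G0 zr wr.
have z0 := normc_ge0 z; have w0 := normc_ge0 w; have r0 := le_trans z0 zr.
have zr2 : 0 <= normc z ^+ 2 <= r ^+ 2 by rewrite sqr_ge0 ler_pXn2r// nnegrE.
have wr2 : 0 <= normc w ^+ 2 <= r ^+ 2 by rewrite sqr_ge0 ler_pXn2r// nnegrE.
have -> : nonlin G z - nonlin G w = (G (normc z ^+ 2))%:C%C * (z - w) +
    (G (normc z ^+ 2) - G (normc w ^+ 2))%:C%C * w.
  by rewrite /nonlin rmorphB /=; ring.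
apply: le_trans (le_normcD _ _) _.
rewrite !ComplexField.Normc.normcM !normc_real.
have Gz : `|G (normc z ^+ 2)| <= Lam * normc z ^+ 2.
  have := HG _ 0 zr2; rewrite G0 !subr0 (ger0_norm (sqr_ge0 _)).
  by apply; rewrite lexx sqr_ge0.
have := HG _ _ zr2 wr2.
rewrite subr_sqr normrM (ger0_norm (addr_ge0 z0 w0)) => Gzw.
have d := normc_le_dist z w.
(* The statement fixes no sign for [Lam]. The Lipschitz bound between 0 and [r ^+ 2] makes
   [Lam * r ^+ 2] nonnegative, hence [Lam] too unless [r = 0], a case treated apart. *)
have Lam0 : 0 <= Lam * r ^+ 2.
  have := HG (r ^+ 2) 0; rewrite G0 !subr0 (ger0_norm (sqr_ge0 r)) !lexx sqr_ge0.
  by move=> /(_ isT isT); exact: le_trans.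
have [r1|r1] := eqVneq r 0.
  have w1 : normc w = 0 by apply/eqP; rewrite eq_le w0 -{1}r1 wr.
  have z1 : normc z = 0 by apply/eqP; rewrite eq_le z0 -{1}r1 zr.
  rewrite w1 mulr0 addr0; move: Gz; rewrite z1 expr0n/= mulr0 => Gz.
  rewrite (_ : `|G 0| = 0) ?mul0r ?r1 ?expr0n/= ?mulr0 ?mul0r//.
  by apply/eqP; rewrite eq_le Gz normr_ge0.
have rp : 0 < r by rewrite lt_neqAle eq_sym r1.
have Lp : 0 <= Lam by rewrite -(pmulr_lge0 _ (exprn_gt0 2 rp)).
have d0 := normc_ge0 (z - w).
have E1 : `|G (normc z ^+ 2)| * normc (z - w) <= Lam * r ^+ 2 * normc (z - w).
  rewrite ler_wpM2r// (le_trans Gz)// ler_wpM2l//; by case/andP: zr2.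
have E2 : `|G (normc z ^+ 2) - G (normc w ^+ 2)| * normc w <=
    Lam * (normc (z - w) * (r + r)) * r.
  apply: ler_pM => //; apply: le_trans Gzw _; rewrite ler_wpM2l//.
  by apply: ler_pM => //; [rewrite addr_ge0|exact: lerD].
apply: le_trans (lerD E1 E2) _; rewrite le_eqVlt; apply/orP; left; apply/eqP; ring.
Qed.

Context (L : R) (L_gt0 : 0 < L).
Local Notation H1pair := (H1pair L).
Local Notation L2per := (L2per L).
Local Notation rdot := (rdot L).
Local Notation l2norm := (l2norm L).

Lemma l2norm_pointwise_le f g (c : R) : L2per f -> L2per g -> 0 <= c ->
  (forall x, normc (f x) <= c * normc (g x)) -> l2norm f <= c * l2norm g.
Proof.
move=> f2 g2 c0 H.
rewrite -(@ler_pXn2r _ 2)// ?nnegrE ?mulr_ge0 ?l2norm_ge0//.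
rewrite exprMn !sqr_l2norm.
have mI : measurable (`]- L, L[ : set (measurableTypeR R)) by [].
have ig := integrable_rdot L_gt0 g2 g2.
rewrite -RintegralZl//; apply: le_Rintegral => //.
- exact: (integrable_rdot L_gt0 f2 f2).
- exact: (integrableZl mI (c ^+ 2) ig).
move=> x _; rewrite -!expr2 -!normc_sqr -exprMn.
by rewrite ler_pXn2r// ?nnegrE ?mulr_ge0 ?normc_ge0.
Qed.

(** [G] is controlled on [[0, r ^+ 2]] only, so measurability is not taken from [G] itself: the
    composite inherits the Holder estimate of [f], hence is continuous, and it is bounded. *)
Lemma L2per_nonlin G f g (Lam r : R) :
  lipschitz_upto G Lam r ->
  G 0 = 0 -> H1pair f g -> (forall x, normc (f x) <= r) ->
  L2per (fun x => nonlin G (f x)).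
Proof.
move=> HG G0 hfg fr.
have lip x y := nonlin_lipschitz HG G0 (fr x) (fr y).
have [pf _] := hfg.
have sqlip x y : normc (nonlin G (f x) - nonlin G (f y)) ^+ 2 <=
    (3 * Lam * r ^+ 2) ^+ 2 * normc (f x - f y) ^+ 2.
  rewrite -exprMn ler_pXn2r// ?nnegrE ?normc_ge0//.
  exact: le_trans (normc_ge0 _) (lip x y).
have hol (x y : R) : `|y - x| <= L *+ 2 -> normc (nonlin G (f y) - nonlin G (f x)) ^+ 2 <=
    `|y - x| * ((3 * Lam * r ^+ 2) ^+ 2 * rdot g g).
  move=> xy; apply: le_trans (sqlip y x) _; rewrite [leRHS]mulrCA ler_wpM2l ?sqr_ge0//.
  exact: H1pair_holder.
have L2 : 0 < L *+ 2 by rewrite pmulrn_lgt0.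
apply: (@bounded_L2per _ _ _ _ ((3 * Lam * r ^+ 2 * r) ^+ 2)) => //.
- by move=> x; rewrite pf.
- apply: continuous_measurable_fun; apply: (holder_half_continuous L2) => x y xy.
  apply: le_trans (hol x y xy).
  by have := Re_sqr_le_normc (nonlin G (f y) - nonlin G (f x)); rewrite !cE.
- apply: continuous_measurable_fun; apply: (holder_half_continuous L2) => x y xy.
  apply: le_trans (hol x y xy).
  by have := Im_sqr_le_normc (nonlin G (f y) - nonlin G (f x)); rewrite !cE.
move=> x _; have r0 : 0 <= r := le_trans (normc_ge0 _) (fr x).
have n0 : normc (0 : R[i]) <= r by rewrite ComplexField.Normc.normc0.
have N0 : nonlin G 0 = 0 by rewrite /nonlin mulr0.
have := nonlin_lipschitz HG G0 (fr x) n0; rewrite N0 !subr0 => H.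
have c0 : 0 <= 3 * Lam * r ^+ 2.
  have := HG (r ^+ 2) 0; rewrite G0 !subr0 (ger0_norm (sqr_ge0 r)) !lexx sqr_ge0.
  by move=> /(_ isT isT)/(le_trans (normr_ge0 _)); rewrite -mulrA => ?; rewrite mulr_ge0.
rewrite ler_pXn2r// ?nnegrE ?normc_ge0 ?(mulr_ge0 c0 r0)//.
by apply: le_trans H _; rewrite ler_wpM2l.
Qed.

End Nonlinearity.

(** * Weak solutions *)

Section Solutions.
Context {R : realType}.
Local Notation mu := (@lebesgue_measure R).
Local Notation Re := complex.Re.
Local Notation Im := complex.Im.
Local Notation normc := ComplexField.Normc.normc.
Implicit Types (f g k : R -> R[i]) (z : R[i]) (G : R -> R) (nu h : R).
Context (L : R) (L_gt0 : 0 < L).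
Local Notation H1pair := (H1pair L).
Local Notation L2per := (L2per L).
Local Notation rdot := (rdot L).
Local Notation idot := (idot L).
Local Notation l2norm := (l2norm L).
Local Notation forced := (forced_schroedinger L).

Lemma near_nonneg (t : R) : 0 < t -> \forall s \near t, 0 <= s.
Proof.
by move=> t0; exists t => //= s; rewrite /ball_/= ltr_distlC subrr => /andP[/ltW].
Qed.

Lemma H1per_pair f : H1per L f -> H1pair f (wderiv L f).
Proof. by case=> pf ex; split => //; exact: (xgetPex _ ex). Qed.

Lemma H1pair_per f g : H1pair f g -> H1per L f.
Proof. by case=> pf w; split => //; exists g. Qed.

Lemma rdot_ae_eql f g k : L2per f -> L2per g -> L2per k ->
  {ae mu, forall x, x \in `]- L, L[ -> f x = g x} -> rdot f k = rdot g k.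
Proof.
move=> f2 g2 k2 fg; congr fine; apply: ae_eq_integral => //.
- by have /integrableP[] := integrable_rdot L_gt0 f2 k2.
- by have /integrableP[] := integrable_rdot L_gt0 g2 k2.
have aeF := ae_filter_ringOfSetsType mu.
by apply: filterS fg => x H /= xI; rewrite H.
Qed.

Lemma rdot_derivative_unique f g1 g2 k : H1pair f g1 -> H1pair f g2 -> L2per k ->
  rdot g1 k = rdot g2 k.
Proof.
move=> h1 h2 k2; apply: rdot_ae_eql (H1pair_unique L_gt0 h1 h2) => //.
  exact: H1pair_L2per h1.
exact: H1pair_L2per h2.
Qed.

(** The weak equation contains the derivatives selected by [wderiv]; this allows any other
    representatives in their place. *)
Lemma idot_derivative_unique f1 g1 g1' f2 g2 g2' :
  H1pair f1 g1 -> H1pair f1 g1' -> H1pair f2 g2 -> H1pair f2 g2' ->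
  idot g1 g2 = idot g1' g2'.
Proof.
move=> h1 h1' h2 h2'.
have l1' := H1pair_L2per h1'; have l2 := H1pair_L2per h2; have l2' := H1pair_L2per h2'.
have -> : idot g1 g2 = idot g1' g2.
  by apply: (rdot_derivative_unique h1 h1'); exact: L2per_mul_i.
rewrite /idot rdotC [RHS]rdotC.
apply: rdot_ae_eql => //; try exact: L2per_mul_i.
have aeF := ae_filter_ringOfSetsType mu.
by apply: filterS (H1pair_unique L_gt0 h2 h2') => x H xI; rewrite H.
Qed.

(** Frees the norm from the choice made by [wderiv], and from extended reals. *)
Lemma H1normE f g : H1pair f g ->
  H1norm L f = (Num.sqrt (l2norm f ^+ 2 + l2norm g ^+ 2))%:E.
Proof.
move=> hfg; have hw := H1per_pair (H1pair_per hfg).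
have wl := H1pair_L2per hw; have gl := H1pair_L2per hfg.
rewrite /H1norm !(sqnormIE L_gt0)//; last exact: (H1pair_L2per_fst L_gt0 hfg).
have -> : rdot (wderiv L f) (wderiv L f) = rdot g g.
  rewrite (rdot_derivative_unique hw hfg wl) rdotC.
  exact: rdot_derivative_unique hw hfg gl.
rewrite -EFinD poweR_EFin powR12_sqrt ?addr_ge0 ?rdot_ge0//.
by rewrite !sqr_l2norm.
Qed.

Lemma L2normE f : L2per f -> L2norm L f = (l2norm f)%:E.
Proof.
move=> f2; rewrite /L2norm (sqnormIE L_gt0 f2) poweR_EFin powR12_sqrt ?rdot_ge0//.
Qed.

Lemma l2norm_le_H1norm f g B : H1pair f g -> (H1norm L f <= B%:E)%E ->
  l2norm f <= B /\ l2norm g <= B.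
Proof.
move=> hfg; rewrite (H1normE hfg) lee_fin => H.
have s0 : 0 <= l2norm f ^+ 2 + l2norm g ^+ 2 by rewrite addr_ge0 ?sqr_ge0.
split; apply: le_trans H; rewrite -[leLHS]ger0_norm ?l2norm_ge0// -sqrtr_sqr ler_wsqrtr//.
  by rewrite lerDl sqr_ge0.
by rewrite lerDr sqr_ge0.
Qed.

Lemma Re_dotI f g : Re (dotI L f g) = rdot f g.
Proof.
rewrite /dotI /cintegral /=; apply: eq_Rintegral => x _.
by case: (f x) => a b; case: (g x) => c d /=; ring.
Qed.

Lemma Im_dotI f g : Im (dotI L f g) = idot f g.
Proof.
rewrite /dotI /cintegral /=; apply: eq_Rintegral => x _.
by case: (f x) => a b; case: (g x) => c d /=; ring.
Qed.

(** The imaginary part of the weak equation: on the left the factor ['i] turns it into the real part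
    of the product, that is [rdot]. *)
Lemma NLS_forced nu G v0 v : NLS_solution nu L G v0 v ->
  (forall t, 0 <= t -> L2per (fun x => nonlin G (v t x))) ->
  forced nu v (fun t => wderiv L (v t)) (fun t x => nonlin G (v t x)).
Proof.
move=> [vH _ vc vd] N2; split => //.
- by move=> t t0; exact: H1per_pair (vH t t0).
- move=> t t0 e e0.
  have e0' : (0%R < e%:E)%E by rewrite lte_fin.
  have := vc t t0.
  move=> /(_ [set y | (y < e%:E)%E] (open_ereal_lt' e0')).
  move=> vcN.
  have {vcN} : nbhs t (fun s : R => `[0, +oo[%classic s -> (H1norm L (v s \- v t)%R < e%:E)%E) := vcN.
  move=> /nbhs_ballP[d /= d0 Hd].
  exists d => // s s0 sd.
  have hs := H1per_pair (vH s s0); have ht := H1per_pair (vH t t0).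
  apply: (l2norm_le_H1norm (H1pairB L_gt0 hs ht)); apply: ltW; apply: Hd.
    by rewrite /ball/= distrC.
  by rewrite /= in_itv/= s0.
move=> phi phix hphi t t0.
have [_] := vd phi (H1pair_per hphi) t t0.
have hv := H1per_pair (vH t (ltW t0)).
rewrite (_ : (fun s => Im _) = (fun s => rdot (v s) phi)); last first.
  by apply/funext => s; rewrite -complexiE Im_mul_i Re_dotI.
congr (is_derive t 1 _ _).
rewrite ImD ImN Im_dotI; congr (_ - _).
have -> (z : R[i]) : Im (nu%:C%C * z) = nu * Im z by case: z => a b /=; rewrite mul0r addr0.
by rewrite Im_dotI (idot_derivative_unique hv hv (H1per_pair (H1pair_per hphi)) hphi).
Qed.

Lemma forcedB nu w wx N w' wx' N' : forced nu w wx N -> forced nu w' wx' N' ->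
  forced nu (fun t => w t \- w' t) (fun t => wx t \- wx' t) (fun t => N t \- N' t).
Proof.
move=> [w1 n1 c1 d1] [w2 n2 c2 d2]; split.
- by move=> t t0; apply: H1pairB => //; [exact: w1|exact: w2].
- by move=> t t0; apply: L2perB => //; [exact: n1|exact: n2].
- move=> t t0 e e0.
  have e2 : 0 < e / 2 by rewrite divr_gt0.
  have [d d0 Hd] := c1 t t0 _ e2; have [d' d'0 Hd'] := c2 t t0 _ e2.
  exists (Num.min d d'); first by rewrite lt_min d0.
  move=> s s0; rewrite lt_min => /andP[/(Hd s s0)[a1 b1] /(Hd' s s0)[a2 b2]].
  have rearr (p q p' q' : R -> R[i]) : (p \- q) \- (p' \- q') = (p \- p') \- (q \- q').
    by apply/funext => x /=; ring.
  have h1s := w1 s s0; have h2s := w2 s s0; have h1t := w1 t t0; have h2t := w2 t t0.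
  have hh1 := H1pairB L_gt0 h1s h1t; have hh2 := H1pairB L_gt0 h2s h2t.
  rewrite (rearr (w s) (w' s)) (rearr (wx s) (wx' s)); split.
    have := l2normB L_gt0 (H1pair_L2per_fst L_gt0 hh1) (H1pair_L2per_fst L_gt0 hh2).
    by move=> /le_trans; apply; rewrite [leRHS]splitr; exact: lerD.
  have := l2normB L_gt0 (H1pair_L2per hh1) (H1pair_L2per hh2).
  by move=> /le_trans; apply; rewrite [leRHS]splitr; exact: lerD.
move=> phi phix hphi t t0.
have phi2 := H1pair_L2per_fst L_gt0 hphi; have phix2 := H1pair_L2per hphi.
have t0' := ltW t0.
have -> : nu * idot (wx t \- wx' t) phix - idot (N t \- N' t) phi =
    (nu * idot (wx t) phix - idot (N t) phi) - (nu * idot (wx' t) phix - idot (N' t) phi).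
  rewrite !idotBl//; [ring|exact: n1|exact: n2|..].
    exact: H1pair_L2per (w1 t t0').
  exact: H1pair_L2per (w2 t t0').
have D : is_derive t 1 (fun s : R => rdot (w s) phi - rdot (w' s) phi)
    ((nu * idot (wx t) phix - idot (N t) phi) - (nu * idot (wx' t) phix - idot (N' t) phi)).
  exact: is_deriveB (d1 _ _ hphi t t0) (d2 _ _ hphi t t0).
(* [rdot] splits only where both functions are known to be in L^2, that is for [s >= 0]; near a
   positive [t] this is enough for the derivative. *)
apply: near_eq_is_derive D.
near=> s; rewrite rdotBl//.
- by apply: (H1pair_L2per_fst L_gt0 (w1 s _)); near: s; exact: near_nonneg.
- by apply: (H1pair_L2per_fst L_gt0 (w2 s _)); near: s; exact: near_nonneg.
Unshelve. all: by end_near. Qed.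

(** The translation is moved onto the test function: pairing [w t (x + h)] with [phi] equals pairing
    [w t] with [phi] translated by [- h], which is again in H^1. *)
Lemma forced_shift nu w wx N h : forced nu w wx N ->
  forced nu (fun t x => w t (x + h)) (fun t x => wx t (x + h)) (fun t x => N t (x + h)).
Proof.
move=> [w1 n1 c1 d1]; split.
- by move=> t t0; apply: H1pair_shift => //; exact: w1.
- by move=> t t0; apply: L2per_shift => //; exact: n1.
- move=> t t0 e e0; have [d d0 Hd] := c1 t t0 _ e0; exists d => // s s0 sd.
  have [a b] := Hd s s0 sd.
  have sh k : L2per k -> l2norm (fun x => k (x + h)) = l2norm k.
    by move=> k2; rewrite /l2norm rdot_shift.
  have hB := H1pairB L_gt0 (w1 s s0) (w1 t t0).
  split.
    by rewrite (sh _ (H1pair_L2per_fst L_gt0 hB)).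
  by rewrite (sh _ (H1pair_L2per hB)).
move=> phi phix hphi t t0.
have hphi' := H1pair_shift L_gt0 (- h) hphi.
have phi2 := H1pair_L2per_fst L_gt0 hphi'; have phix2 := H1pair_L2per hphi'.
have back k : (fun x => k (x + h - h)) = k by apply/funext => x; rewrite addrK.
have t0' := ltW t0.
have := d1 _ _ hphi' t t0.
rewrite -(idot_shift L_gt0 h (H1pair_L2per (w1 t t0')) phix2).
rewrite -(idot_shift L_gt0 h (n1 t t0') phi2) !back => D.
apply: near_eq_is_derive D; near=> s.
rewrite -(rdot_shift L_gt0 h _ phi2) ?back//.
by apply: (H1pair_L2per_fst L_gt0 (w1 s _)); near: s; exact: near_nonneg.
Unshelve. all: by end_near. Qed.

End Solutions.

(** * Closeness of solutions *)

Section Closeness.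
Context {R : realType}.
Local Notation normc := ComplexField.Normc.normc.
Implicit Types (f g : R -> R[i]) (G : R -> R) (u U : R -> R -> R[i]).
Context (L : R) (L_gt0 : 0 < L).
Local Notation H1pair := (H1pair L).
Local Notation L2per := (L2per L).
Local Notation l2norm := (l2norm L).

(** The constant of [sobolev_embedding], doubled because the function and its derivative are each
    bounded by [B], so that their squares sum to at most 2 B^2. *)
Definition sobolev_cst : R := Num.sqrt (2 * (L^-1 + 2 * L)).

Lemma sobolev_cst_gt0 : 0 < sobolev_cst.
Proof. by rewrite sqrtr_gt0 mulr_gt0// addr_gt0 ?invr_gt0// mulr_gt0. Qed.

Lemma normc_le_sobolev f g (B : R) x : H1pair f g -> l2norm f <= B -> l2norm g <= B ->
  normc (f x) <= sobolev_cst * B.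
Proof.
move=> hfg fB gB; have B0 : 0 <= B := le_trans (l2norm_ge0 _ _) fB.
have c0 := ltW sobolev_cst_gt0.
rewrite -(@ler_pXn2r _ 2)// ?nnegrE ?normc_ge0 ?mulr_ge0//.
have k0 : 0 <= L^-1 + 2 * L by rewrite addr_ge0 ?invr_ge0 ?mulr_ge0// ltW.
apply: le_trans (sobolev_embedding L_gt0 x hfg) _.
rewrite exprMn sqr_sqrtr ?mulr_ge0// -!sqr_l2norm -mulrA mulrCA ler_wpM2l//.
by rewrite mulrDl mul1r; apply: lerD; rewrite ler_pXn2r// ?nnegrE ?l2norm_ge0.
Qed.

Lemma l2norm_translation f g h : H1pair f g -> 0 <= h ->
  l2norm (fun x => f (x + h) - f x) <= h * l2norm g.
Proof.
move=> hfg h0; rewrite -(@ler_pXn2r _ 2)// ?nnegrE ?mulr_ge0 ?l2norm_ge0//.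
by rewrite exprMn !sqr_l2norm; exact: H1pair_translation.
Qed.

(** The entry point of the global well-posedness bound: smallness of the initial value becomes
    smallness at all times. *)
Lemma sup_H1norm_bounds nu G v0 v (m c D e : R) : NLS_solution nu L G v0 v -> 0 <= m ->
  (ereal_sup [set H1norm L (v t) | t in `[0, +oo[]%R <= m%:E * H1norm L v0)%E ->
  (H1norm L v0 <= (c * e)%:E)%E -> m * c * e <= D ->
  forall t, 0 <= t -> l2norm (v t) <= D /\ l2norm (wderiv L (v t)) <= D.
Proof.
move=> [vH _ _ _] m0 vsup v0c cD t t0.
apply: (l2norm_le_H1norm L_gt0 (H1per_pair (vH t t0))).
apply: (@le_trans _ _ (m * c * e)%:E); last by rewrite lee_fin.
apply: le_trans (_ : _ <= m%:E * H1norm L v0)%E _.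
  apply: le_trans vsup; apply: ereal_sup_ubound; exists t => //=.
  by rewrite in_itv/= t0.
by rewrite -mulrA EFinM; apply: lee_wpmul2l.
Qed.

Lemma Linfnorm_le f (B : R) : (forall x, normc (f x) <= B) -> (Linfnorm L f <= B%:E)%E.
Proof.
move=> fB; have B0 : 0 <= B := le_trans (normc_ge0 _) (fB 0).
(* The norm is an essential supremum, with default value 0 on a space of measure zero. *)
rewrite /Linfnorm unlock; case: ifPn => _; last by rewrite lee_fin.
apply/ess_supP; apply: aeW => x /=.
by rewrite lee_fin ger0_norm ?normc_ge0// fB.
Qed.

Lemma l2norm_nonlin_le G f g (Lam r D : R) : lipschitz_upto G Lam r -> G 0 = 0 ->
  0 <= Lam -> H1pair f g -> (forall x, normc (f x) <= r) -> l2norm f <= D ->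
  l2norm (fun x => nonlin G (f x)) <= 3 * Lam * r ^+ 2 * D.
Proof.
move=> HG G0 Lam0 hfg fr fD.
have r0 : 0 <= r := le_trans (normc_ge0 _) (fr 0).
have c0 : 0 <= 3 * Lam * r ^+ 2 by rewrite !mulr_ge0// sqr_ge0.
apply: le_trans (_ : 3 * Lam * r ^+ 2 * l2norm f <= _); last by rewrite ler_wpM2l.
apply: l2norm_pointwise_le => //.
- exact: (L2per_nonlin L_gt0 HG G0 hfg fr).
- exact: (H1pair_L2per_fst L_gt0 hfg).
move=> x; have n0 : normc (0 : R[i]) <= r by rewrite ComplexField.Normc.normc0.
by have := nonlin_lipschitz HG G0 (fr x) n0; rewrite {2}/nonlin mulr0 !subr0.
Qed.

(** A substitute for the chain rule: pointwise, the increment of the nonlinear term is controlled by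
    that of [f], whose L^2 norm is at most [h] times that of [g]. *)
Lemma l2norm_nonlin_translation_le G f g (Lam r D h : R) : lipschitz_upto G Lam r ->
  G 0 = 0 -> 0 <= Lam -> H1pair f g -> (forall x, normc (f x) <= r) -> l2norm g <= D ->
  0 <= h ->
  l2norm (fun x => nonlin G (f (x + h)) - nonlin G (f x)) <= h * (3 * Lam * r ^+ 2 * D).
Proof.
move=> HG G0 Lam0 hfg fr gD h0.
have r0 : 0 <= r := le_trans (normc_ge0 _) (fr 0).
have c0 : 0 <= 3 * Lam * r ^+ 2 by rewrite !mulr_ge0// sqr_ge0.
have f2 := H1pair_L2per_fst L_gt0 hfg; have N2 := L2per_nonlin L_gt0 HG G0 hfg fr.
apply: le_trans (_ : 3 * Lam * r ^+ 2 * l2norm (fun x => f (x + h) - f x) <= _).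
  apply: l2norm_pointwise_le => //.
  - exact: (L2perB L_gt0 (L2per_shift L_gt0 h N2) N2).
  - exact: (L2perB L_gt0 (L2per_shift L_gt0 h f2) f2).
  by move=> x; exact: nonlin_lipschitz.
rewrite [leRHS]mulrCA ler_wpM2l//.
by apply: le_trans (l2norm_translation hfg h0) _; rewrite ler_wpM2l.
Qed.

(* The H^1 part applies the L^2 estimate to the increment w (x + h) - w x,
   which solves the same kind of equation because it has constant coefficients,
   and divides by h. *)
Lemma difference_estimate nu G1 G2 (u0 U0 : R -> R[i]) u U (Lam D r T : R) :
  0 < nu -> 0 <= T -> 0 <= Lam ->
  NLS_solution nu L G1 u0 u -> NLS_solution nu L G2 U0 U ->
  G1 0 = 0 -> G2 0 = 0 -> lipschitz_upto G1 Lam r -> lipschitz_upto G2 Lam r ->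
  sobolev_cst * D <= r ->
  (forall t, 0 <= t -> l2norm (u t) <= D /\ l2norm (wderiv L (u t)) <= D) ->
  (forall t, 0 <= t -> l2norm (U t) <= D /\ l2norm (wderiv L (U t)) <= D) ->
  forall t, 0 <= t <= T ->
    l2norm (u t \- U t) <= l2norm (u0 \- U0) + 12 * T * Lam * r ^+ 2 * D /\
    l2norm (wderiv L (u t) \- wderiv L (U t)) <=
      l2norm (wderiv L u0 \- wderiv L U0) + 12 * T * Lam * r ^+ 2 * D.
Proof.
move=> nu0 T0 Lam0 su sU G10 G20 lip1 lip2 Dr bu bU t /andP[t0 tT].
have [uH u0E _ _] := su; have [UH U0E _ _] := sU.
have hu s (s0 : 0 <= s) := H1per_pair (uH s s0).
have hU s (s0 : 0 <= s) := H1per_pair (UH s s0).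
have ur s x : 0 <= s -> normc (u s x) <= r.
  by move=> s0; have [a b] := bu s s0; apply: le_trans (normc_le_sobolev x (hu s s0) a b) Dr.
have Ur s x : 0 <= s -> normc (U s x) <= r.
  by move=> s0; have [a b] := bU s s0; apply: le_trans (normc_le_sobolev x (hU s s0) a b) Dr.
have D0 : 0 <= D := le_trans (l2norm_ge0 _ _) (bu 0 (lexx 0)).1.
have nu2 s : 0 <= s -> L2per (fun x => nonlin G1 (u s x)).
  by move=> s0; apply: (L2per_nonlin L_gt0 lip1 G10 (hu s s0)) => x; exact: ur.
have nU2 s : 0 <= s -> L2per (fun x => nonlin G2 (U s x)).
  by move=> s0; apply: (L2per_nonlin L_gt0 lip2 G20 (hU s s0)) => x; exact: Ur.
have fw := forcedB L_gt0 (NLS_forced L_gt0 su nu2) (NLS_forced L_gt0 sU nU2).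
(* One summand for each nonlinear term, combined by the triangle inequality; with the factor [2 * T]
   of the energy estimate this gives 12. *)
pose B := 3 * Lam * r ^+ 2 * D + 3 * Lam * r ^+ 2 * D.
have c0 : 0 <= 3 * Lam * r ^+ 2 * D.
  by apply: mulr_ge0 => //; apply: mulr_ge0; [exact: mulr_ge0|exact: sqr_ge0].
have B0 : 0 <= B by exact: addr_ge0.
have BE : 2 * t * B <= 12 * T * Lam * r ^+ 2 * D.
  have -> : 12 * T * Lam * r ^+ 2 * D = 2 * T * B by rewrite /B; ring.
  by rewrite ler_wpM2r// ler_wpM2l.
have hw s (s0 : 0 <= s) := H1pairB L_gt0 (hu s s0) (hU s s0).
(* Crude bounds, uniform in time, that supply the a priori bound [S0] of the energy estimate. *)
have bw s : 0 <= s -> l2norm (u s \- U s) <= D + D /\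
    l2norm (wderiv L (u s) \- wderiv L (U s)) <= D + D.
  move=> s0; have [a1 b1] := bu s s0; have [a2 b2] := bU s s0; split.
  - have := l2normB L_gt0 (H1pair_L2per_fst L_gt0 (hu s s0)) (H1pair_L2per_fst L_gt0 (hU s s0)).
    by move=> /le_trans; apply; exact: lerD.
  - have := l2normB L_gt0 (H1pair_L2per (hu s s0)) (H1pair_L2per (hU s s0)).
    by move=> /le_trans; apply; exact: lerD.
rewrite -u0E -U0E; split.
  have NB s : 0 <= s -> l2norm ((fun x => nonlin G1 (u s x)) \- (fun x => nonlin G2 (U s x))) <= B.
    move=> s0; apply: le_trans (l2normB L_gt0 (nu2 s s0) (nU2 s s0)) _; apply: lerD.
    - by apply: (l2norm_nonlin_le lip1 G10 Lam0 (hu s s0)) => [x|]; [exact: ur|exact: (bu s s0).1].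
    - by apply: (l2norm_nonlin_le lip2 G20 Lam0 (hU s s0)) => [x|]; [exact: Ur|exact: (bU s s0).1].
  have := energy_estimate L_gt0 nu0 fw NB (fun s s0 => (bw s s0).1) t0.
  by move=> /le_trans; apply; rewrite lerD2l.
apply: (l2norm_derivative_le L_gt0 (hw t t0)).
  by rewrite addr_ge0 ?l2norm_ge0// (le_trans _ BE)// !mulr_ge0.
move=> h h0.
have fW := forcedB L_gt0 (forced_shift L_gt0 h fw) fw.
have NB s : 0 <= s -> l2norm
    ((fun x => nonlin G1 (u s (x + h)) - nonlin G2 (U s (x + h))) \-
     (fun x => nonlin G1 (u s x) - nonlin G2 (U s x))) <= h * B.
  move=> s0.
  have -> : ((fun x => nonlin G1 (u s (x + h)) - nonlin G2 (U s (x + h))) \-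
     (fun x => nonlin G1 (u s x) - nonlin G2 (U s x))) =
     (fun x => nonlin G1 (u s (x + h)) - nonlin G1 (u s x)) \-
     (fun x => nonlin G2 (U s (x + h)) - nonlin G2 (U s x)).
    by apply/funext => x /=; ring.
  have d1 := L2perB L_gt0 (L2per_shift L_gt0 h (nu2 s s0)) (nu2 s s0).
  have d2 := L2perB L_gt0 (L2per_shift L_gt0 h (nU2 s s0)) (nU2 s s0).
  apply: le_trans (l2normB L_gt0 d1 d2) _; rewrite mulrDr; apply: lerD.
  - apply: (l2norm_nonlin_translation_le lip1 G10 Lam0 (hu s s0)) => [x||]; last exact: ltW.
      exact: ur.
    exact: (bu s s0).2.
  - apply: (l2norm_nonlin_translation_le lip2 G20 Lam0 (hU s s0)) => [x||]; last exact: ltW.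
      exact: Ur.
    exact: (bU s s0).2.
have Wx s : 0 <= s -> l2norm (fun x => (u s (x + h) - U s (x + h)) - (u s x - U s x)) <=
    h * l2norm (wderiv L (u s) \- wderiv L (U s)).
  by move=> s0; exact: (l2norm_translation (hw s s0) (ltW h0)).
have WB s : 0 <= s -> l2norm (fun x => (u s (x + h) - U s (x + h)) - (u s x - U s x)) <=
    h * (D + D).
  by move=> s0; apply: le_trans (Wx s s0) _; rewrite ler_pM2l//; exact: (bw s s0).2.
(* Both terms of the resulting bound carry a factor [h]: the initial increment by [Wx], the forcing
   by [NB]. *)
have := energy_estimate L_gt0 nu0 fW NB WB t0.
move=> /le_trans; apply; rewrite [leRHS]mulrDr; apply: lerD; first exact: Wx.
by rewrite mulrCA ler_pM2l.
Qed.

End Closeness.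

(** * Choice of constants and the two closeness statements *)

Theorem theorem4p3 (R : realType) (p nu L K : R) (F : R -> R)
  (hp : 1 <= p) (hnu : 0 < nu) (hL : 0 < L) (hK : 0 < K)
  (hFlip : forall x y : R, 0 <= x -> 0 <= y ->
    `|F x - F y| <= K * (`|x| `^ (p - 1) + `|y| `^ (p - 1)) * `|x - y|)
  (hF0 : F 0 = 0)
  (hFder : forall x : R, 0 <= x ->
    derivable F x 1 /\ `|derive1 F x| <= K * `|x| `^ (p - 1))
  (mu gamma : R) (hmu : 0 < mu) (hgamma : 0 < gamma)
  (m M : R) (hm : 0 < m) (hM : 0 < M)
  (c0 C0 Tf : R) (hc0 : 0 < c0) (hC0 : 0 < C0) (hTf : 0 < Tf) :
  (forall C : R, 0 < C ->
    exists2 Ct : R, 0 < Ct &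
    forall (eps : R) (u0 U0 : R -> R[i]) (u U : R -> R -> R[i]),
      0 < eps -> eps < 1 ->
      NLS_solution nu L (fun r => mu * r) u0 u ->
      NLS_solution nu L (fun r => gamma * F r) U0 U ->
      (ereal_sup [set H1norm L (u t) | t in `[0, +oo[]%R <= m%:E * H1norm L u0)%E ->
      (ereal_sup [set H1norm L (U t) | t in `[0, +oo[]%R <= M%:E * H1norm L U0)%E ->
      (L2norm L (u0 \- U0)%R <= (C * eps ^+ 3)%:E)%E ->
      (H1norm L u0 <= (c0 * eps)%:E)%E ->
      (H1norm L U0 <= (C0 * eps)%:E)%E ->
      (ereal_sup [set L2norm L (u t \- U t) | t in `[0, Tf]]%R
        <= (Ct * eps ^+ 3)%:E)%E)
  /\
  (forall C1 : R,
    exists Ct1 Ct2 : R, [/\ 0 < Ct1, 0 < Ct2 &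
    forall (eps : R) (u0 U0 : R -> R[i]) (u U : R -> R -> R[i]),
      0 < eps -> eps < 1 ->
      NLS_solution nu L (fun r => mu * r) u0 u ->
      NLS_solution nu L (fun r => gamma * F r) U0 U ->
      (ereal_sup [set H1norm L (u t) | t in `[0, +oo[]%R <= m%:E * H1norm L u0)%E ->
      (ereal_sup [set H1norm L (U t) | t in `[0, +oo[]%R <= M%:E * H1norm L U0)%E ->
      (H1norm L u0 <= (c0 * eps)%:E)%E ->
      (H1norm L U0 <= (C0 * eps)%:E)%E ->
      (H1norm L (u0 \- U0)%R <= (C1 * eps ^+ 3)%:E)%E ->
      (ereal_sup [set H1norm L (u t \- U t) | t in `[0, Tf]]%R
        <= (Ct1 * eps ^+ 3)%:E)%E /\
      (ereal_sup [set Linfnorm L (u t \- U t) | t in `[0, Tf]]%R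
        <= (Ct2 * eps ^+ 3)%:E)%E]).
Proof.
(* [D0 * eps] bounds the H^1 norms of both solutions at all times. *)
pose D0 := m * c0 + M * C0.
have D0_gt0 : 0 < D0 by rewrite addr_gt0// mulr_gt0.
have S0 := sobolev_cst_gt0 hL.
(* Bounds |u|^2 and |U|^2 for every [eps < 1], so that [Lam] can be fixed before [eps]. *)
pose Q := (sobolev_cst L * D0) ^+ 2 + 1.
have Q0 : 0 <= Q by rewrite addr_ge0// sqr_ge0.
(* One constant for both nonlinearities: [mu] for the cubic term, and for [gamma * F] the bound on
   [F] with both arguments at most [Q], where [p >= 1] makes the power monotone. *)
pose Lam := mu + gamma * (K * (Q `^ (p - 1) + Q `^ (p - 1))).
have QK : 0 <= K * (Q `^ (p - 1) + Q `^ (p - 1)).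
  by rewrite mulr_ge0 ?(ltW hK)// addr_ge0// powR_ge0.
have Lam0 : 0 <= Lam by rewrite addr_ge0 ?(ltW hmu)// mulr_ge0// ltW.
(* With [r = sobolev_cst L * (D0 * eps)] and [D = D0 * eps], the error term of [difference_estimate]
   is exactly [A * eps ^+ 3]. *)
pose A := 12 * Tf * Lam * (sobolev_cst L * D0) ^+ 2 * D0.
have A0 : 0 <= A by rewrite !mulr_ge0 ?sqr_ge0// ltW.
have p1 : 0 <= p - 1 by rewrite subr_ge0.
have rQ (e : R) : 0 < e -> e < 1 -> (sobolev_cst L * (D0 * e)) ^+ 2 <= Q.
  move=> e0 e1; rewrite mulrA exprMn (@le_trans _ _ ((sobolev_cst L * D0) ^+ 2))//.
    by rewrite ler_piMr ?sqr_ge0// expr_le1// ltW.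
  by rewrite lerDl.
have lip1 (e : R) : 0 < e -> e < 1 ->
    lipschitz_upto (fun r => mu * r) Lam (sobolev_cst L * (D0 * e)).
  move=> e0 e1 a b _ _; rewrite -mulrBr normrM (gtr0_norm hmu) ler_wpM2r//.
  by rewrite lerDl mulr_ge0// ltW.
have lip2 (e : R) : 0 < e -> e < 1 ->
    lipschitz_upto (fun r => gamma * F r) Lam (sobolev_cst L * (D0 * e)).
  move=> e0 e1 a b /andP[a0 ar] /andP[b0 br].
  rewrite -mulrBr normrM (gtr0_norm hgamma).
  have powQ (c : R) : 0 <= c -> c <= (sobolev_cst L * (D0 * e)) ^+ 2 ->
      `|c| `^ (p - 1) <= Q `^ (p - 1).
    move=> cge0 cr; rewrite ger0_norm//.
    by apply: ge0_ler_powR; rewrite ?nnegrE// (le_trans cr)// rQ.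
  apply: le_trans (_ : gamma * (K * (Q `^ (p - 1) + Q `^ (p - 1)) * `|a - b|) <= _).
    rewrite ler_pM2l//; apply: le_trans (hFlip a b a0 b0) _.
    by rewrite ler_wpM2r// ler_pM2l//; apply: lerD; exact: powQ.
  by rewrite mulrA ler_wpM2r// lerDr ltW.
have core (e : R) (u0 U0 : R -> R[i]) (u U : R -> R -> R[i]) : 0 < e -> e < 1 ->
    NLS_solution nu L (fun r => mu * r) u0 u ->
    NLS_solution nu L (fun r => gamma * F r) U0 U ->
    (ereal_sup [set H1norm L (u t) | t in `[0%R, +oo[] <= m%:E * H1norm L u0)%E ->
    (ereal_sup [set H1norm L (U t) | t in `[0%R, +oo[] <= M%:E * H1norm L U0)%E ->
    (H1norm L u0 <= (c0 * e)%:E)%E -> (H1norm L U0 <= (C0 * e)%:E)%E ->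
    forall t, 0 <= t <= Tf ->
    l2norm L (u t \- U t) <= l2norm L (u0 \- U0) + A * e ^+ 3 /\
    l2norm L (wderiv L (u t) \- wderiv L (U t)) <=
      l2norm L (wderiv L u0 \- wderiv L U0) + A * e ^+ 3.
  move=> e0 e1 su sU supu supU u0c U0c.
  have bu : m * c0 * e <= D0 * e by rewrite ler_pM2r// lerDl mulr_ge0// ltW.
  have bU : M * C0 * e <= D0 * e by rewrite ler_pM2r// lerDr mulr_ge0// ltW.
  have gF0 : gamma * F 0 = 0 by rewrite hF0 mulr0.
  have := difference_estimate hL hnu (ltW hTf) Lam0 su sU (mulr0 mu) gF0
    (lip1 e e0 e1) (lip2 e e0 e1) (lexx _)
    (sup_H1norm_bounds hL su (ltW hm) supu u0c bu)
    (sup_H1norm_bounds hL sU (ltW hM) supU U0c bU).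
  by rewrite (_ : 12 * Tf * Lam * _ ^+ 2 * _ = A * e ^+ 3)//; rewrite /A; ring.
split=> [C C_gt0|C1].
  exists (C + A) => [|e u0 U0 u U e0 e1 su sU supu supU d0 u0c U0c].
    by rewrite ltr_wpDr.
  have [uH u0E _ _] := su; have [UH U0E _ _] := sU.
  have w2 t : 0 <= t -> L2per L (u t \- U t).
    move=> t0; have hw := H1pairB hL (H1per_pair (uH t t0)) (H1per_pair (UH t t0)).
    exact: (H1pair_L2per_fst hL hw).
  apply: ge_ereal_sup => _ [t /= tT <-].
  rewrite in_itv/= in tT; have [t0 _] := andP tT.
  rewrite (L2normE hL (w2 t t0)) lee_fin.
  have := (core e u0 U0 u U e0 e1 su sU supu supU u0c U0c t tT).1.
  move=> /le_trans; apply; rewrite mulrDl lerD2r.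
  move: d0; rewrite -u0E -U0E (L2normE hL (w2 0 (lexx 0))) lee_fin; exact.
(* [C1] may have any sign, hence its absolute value; the summand 1 makes [E] positive. *)
pose E := `|C1| + 1 + A.
have E0 : 0 < E by rewrite ltr_wpDr// ltr_wpDl.
(* The factor 2 absorbs the two squares in the H^1 norm; the second constant comes from the Sobolev
   embedding. *)
exists (2 * E), (sobolev_cst L * E); split; [by rewrite mulr_gt0..|].
move=> e u0 U0 u U e0 e1 su sU supu supU u0c U0c d0.
have [uH u0E _ _] := su; have [UH U0E _ _] := sU.
have e3 : 0 <= e ^+ 3 by rewrite exprn_ge0 ?(ltW e0).
have hw t (t0 : 0 <= t) := H1pairB hL (H1per_pair (uH t t0)) (H1per_pair (UH t t0)).
have [i0 i1] : l2norm L (u0 \- U0) <= C1 * e ^+ 3 /\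
    l2norm L (wderiv L u0 \- wderiv L U0) <= C1 * e ^+ 3.
  rewrite -u0E -U0E; apply: (l2norm_le_H1norm hL (hw 0 (lexx 0))).
  by rewrite u0E U0E.
have C1E : C1 * e ^+ 3 + A * e ^+ 3 <= E * e ^+ 3.
  rewrite -mulrDl ler_wpM2r// lerD2r (le_trans (ler_norm _))// lerDl//.
have bd t : 0 <= t <= Tf -> l2norm L (u t \- U t) <= E * e ^+ 3 /\
    l2norm L (wderiv L (u t) \- wderiv L (U t)) <= E * e ^+ 3.
  move=> tT; have [a b] := core e u0 U0 u U e0 e1 su sU supu supU u0c U0c t tT.
  split; [apply: le_trans a _|apply: le_trans b _].
  - by apply: le_trans C1E; rewrite lerD2r.
  - by apply: le_trans C1E; rewrite lerD2r.
split; apply: ge_ereal_sup => _ [t /= tT <-].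
  rewrite in_itv/= in tT; have [t0 _] := andP tT; have [a b] := bd t tT.
  rewrite (H1normE hL (hw t t0)) lee_fin.
  have Ee : 0 <= E * e ^+ 3 := mulr_ge0 (ltW E0) e3.
  have EE : 0 <= 2 * E * e ^+ 3 by rewrite -mulrA mulr_ge0.
  rewrite -(@ler_pXn2r _ 2)// ?nnegrE ?sqrtr_ge0//.
  rewrite sqr_sqrtr ?addr_ge0 ?sqr_ge0// -mulrA exprMn.
  have a2 : l2norm L (u t \- U t) ^+ 2 <= (E * e ^+ 3) ^+ 2.
    by rewrite ler_pXn2r// nnegrE l2norm_ge0.
  have b2 : l2norm L (wderiv L (u t) \- wderiv L (U t)) ^+ 2 <= (E * e ^+ 3) ^+ 2.
    by rewrite ler_pXn2r// nnegrE l2norm_ge0.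
  apply: le_trans (lerD a2 b2) _.
  by have := sqr_ge0 (E * e ^+ 3); lra.
rewrite in_itv/= in tT; have [t0 _] := andP tT; have [a b] := bd t tT.
apply: Linfnorm_le => x; rewrite -mulrA.
exact: (normc_le_sobolev hL x (hw t t0) a b).
Qed.
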